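(* Let $1 \le p \le \infty$, and let $\Delta \colon S^+_{C^1,p} \to S^+_{C^1,p}$ be a surjective isometry with respect to the norm $\|\cdot\|_{\sigma,p}$. Then there exists an isometric order isomorphism $\mathcal{T} \colon C^1_{\mathbb{R}}[0,1] \to C^1_{\mathbb{R}}[0,1]$ such that $\mathcal{T}|_{S^+_{C^1,p}} = \Delta$.
   Context: $C^1_{\mathbb{R}}[0,1]$ is the real vector space of all continuously differentiable real-valued functions on $[0,1]$, with norm $\|f\|_{\sigma,p} = (|f(0)|^p + \|f'\|_\infty^p)^{1/p}$ for $1 \le p < \infty$ and $\|f\|_{\sigma,\infty} = \max\{|f(0)|, \|f'\|_\infty\}$, where $\|\cdot\|_\infty$ is the supremum norm. It is ordered by: $f \le g$ if and only if $f(0) \le g(0)$ and $f' \le g'$ on $[0,1]$. The positive part of the unit sphere is $S^+_{C^1,p} = \{ f \in C^1_{\mathbb{R}}[0,1] : \|f\|_{\sigma,p} = 1,\ f \ge 0\}$, where $f \ge 0$ refers to this order. A map between subsets of normed spaces is an isometry if it preserves the distances $\|f-g\|$ (no linearity is assumed). An isometric order isomorphism is a surjective real-linear isometry $\mathcal{T}$ such that $\mathcal{T}(f) \le \mathcal{T}(g)$ if and only if $f \le g$. *)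

(* Defs.v *)
From HB Require Import structures.
From mathcomp Require Import all_boot all_order all_algebra.
From mathcomp Require Import all_classical all_reals all_analysis.
From mathcomp Require Import ring lra.

Set Implicit Arguments.
Unset Strict Implicit.
Unset Printing Implicit Defensive.

Import Order.TTheory GRing.Theory Num.Theory.
Import numFieldNormedType.Exports.

Local Open Scope classical_set_scope.
Local Open Scope ring_scope.

(* As a [set_type] this carries the subspace topology, so that [x^'] below is
   one-sided at the two endpoints of the interval. *)
Definition I01 (R : realType) : Type := set_type (`[0%R : R, 1%R]%classic).

HB.instance Definition _ (R : realType) := PseudoMetric.on (I01 R).

Lemma zero_in01 (R : realType) : (0 : R) \in `[0%R : R, 1%R]%classic.
Proof. by apply: mem_set; rewrite /= in_itv /= lexx ler01. Qed.

Definition zero01 (R : realType) : I01 R := exist _ 0 (zero_in01 R).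

Definition diff_quot01 (R : realType) (f : I01 R -> R^o) (x y : I01 R) : R^o :=
  (f y - f x) / (\val y - \val x).

Definition derivable01 (R : realType) (f : I01 R -> R^o) : Prop :=
  forall x : I01 R, cvg (diff_quot01 f x y @[y --> x^']).

Definition deriv01 (R : realType) (f : I01 R -> R^o) (x : I01 R) : R^o :=
  lim (diff_quot01 f x y @[y --> x^']).

Definition is_C1 (R : realType) : {pred I01 R -> R^o} :=
  mem [set f : I01 R -> R^o | derivable01 f /\ continuous (deriv01 f)].
Arguments is_C1 : clear implicits.

Lemma near_point01 (R : realType) (r e : R) : 0 <= r <= 1 -> 0 < e ->
  exists z : R, [/\ 0 <= z <= 1, z != r & `|r - z| < e].
Proof.
move=> /andP[r0 r1] e0; have [rh|rh] := lerP r 2^-1.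
  exists (r + Num.min (e / 2) 2^-1); rewrite /Num.min.
  case: ltP => h; split; try (by apply/andP; split; lra);
    try (by apply/eqP; lra).
  - by rewrite opprD addrA subrr add0r normrN gtr0_norm; lra.
  - by rewrite opprD addrA subrr add0r normrN gtr0_norm; lra.
exists (r - Num.min (e / 2) 2^-1); rewrite /Num.min.
case: ltP => h; split; try (by apply/andP; split; lra);
  try (by apply/eqP; lra).
- by rewrite opprB addrC subrK gtr0_norm; lra.
- by rewrite opprB addrC subrK gtr0_norm; lra.
Qed.

Global Instance I01_dnbhs_proper (R : realType) (x : I01 R) :
  ProperFilter x^'.
Proof.
split; last exact: dnbhs_filter.
move/nbhs_ballP => [e /= e0 H].
have /= := set_mem (valP x); rewrite in_itv /= => x01.
have [z [z01 zx xz]] := near_point01 x01 e0.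
have zI : z \in `[0%R : R, 1%R]%classic by apply: mem_set; rewrite /= in_itv.
by apply: (H (exist _ z zI : I01 R)).
Qed.

Lemma diff_quot01_lin (R : realType) (a : R) (f g : I01 R -> R^o) x :
  diff_quot01 (a *: f + g) x = a *: diff_quot01 f x + diff_quot01 g x.
Proof.
apply/funext => y; rewrite /diff_quot01 !fctE /= /GRing.scale /=.
by ring.
Qed.

Lemma cvg_diff_quot01_lin (R : realType) (a : R) (f g : I01 R -> R^o) x :
  derivable01 f -> derivable01 g ->
  diff_quot01 (a *: f + g) x y @[y --> x^']
    --> a *: deriv01 f x + deriv01 g x.
Proof.
move=> df dg; rewrite diff_quot01_lin.
by apply: cvgD; [apply: cvgZl_tmp; exact: df|exact: dg].
Qed.

Lemma deriv01_lin (R : realType) (a : R) (f g : I01 R -> R^o) :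
  derivable01 f -> derivable01 g ->
  deriv01 (a *: f + g) = a *: deriv01 f + deriv01 g.
Proof.
move=> df dg; apply/funext => x.
by apply: cvg_lim => //; exact: cvg_diff_quot01_lin.
Qed.

Lemma C1_submod_closed (R : realType) : submod_closed (is_C1 R).
Proof.
split.
  apply: mem_set => /=.
  have q0 x : diff_quot01 (0 : I01 R -> R^o) x = cst 0.
    by apply/funext => y; rewrite /diff_quot01 subrr mul0r.
  have -> : deriv01 (0 : I01 R -> R^o) = cst 0.
    apply/funext => x; rewrite /deriv01 q0.
    by apply: cvg_lim => //; exact: cvg_cst.
  split=> x; last exact: cst_continuous.
  by rewrite q0; exact: is_cvg_cst.
move=> a f g /set_mem[df cf] /set_mem[dg cg]; apply: mem_set; split.
  by move=> x; apply/cvg_ex; exists (a *: deriv01 f x + deriv01 g x);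
    exact: cvg_diff_quot01_lin.
rewrite deriv01_lin // => x.
apply: (@continuousD _ _ _ (a *: deriv01 f) (deriv01 g)); last exact: cg.
apply: (@continuousZl_tmp R R^o _ (deriv01 f) a x); exact: cf.
Qed.

HB.instance Definition _ (R : realType) :=
  GRing.isSubmodClosed.Build R (I01 R -> R^o) (is_C1 R)
    (@C1_submod_closed R).

Record C1 (R : realType) := MkC1 {
  C1_fun :> I01 R -> R^o;
  C1_funP : C1_fun \in is_C1 R
}.

HB.instance Definition _ (R : realType) := [isSub for @C1_fun R].
HB.instance Definition _ (R : realType) := [Choice of C1 R by <:].
HB.instance Definition _ (R : realType) :=
  [SubChoice_isSubLmodule of C1 R by <:].

Definition sup_norm01 (R : realType) (u : I01 R -> R^o) : R :=
  sup (range (fun x => `|u x|)).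

(* The value at [-oo] is junk: only exponents [1 <= p] are ever used. *)
Definition norm_sigma (R : realType) (p : \bar R) (f : C1 R) : R :=
  match p with
  | r%:E => (`|f (zero01 R)| `^ r + sup_norm01 (deriv01 f) `^ r) `^ r^-1
  | +oo%E => Num.max `|f (zero01 R)| (sup_norm01 (deriv01 f))
  | -oo%E => 0
  end.

Definition C1_le (R : realType) (f g : C1 R) : Prop :=
  f (zero01 R) <= g (zero01 R) /\ forall x, deriv01 f x <= deriv01 g x.

Definition pos_sphere (R : realType) (p : \bar R) : set (C1 R) :=
  [set f | norm_sigma p f = 1 /\ C1_le 0 f].

Definition isometry_on (R : realType) (p : \bar R) (A B : set (C1 R))
    (F : A -> B) : Prop :=
  forall f g : A,
    norm_sigma p (\val (F f) - \val (F g)) = norm_sigma p (\val f - \val g).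

Definition isometric_order_iso (R : realType) (p : \bar R)
    (T : {linear C1 R -> C1 R}) : Prop :=
  [/\ forall g, exists f, T f = g,
      forall f g, norm_sigma p (T f - T g) = norm_sigma p (f - g)
    & forall f g, C1_le (T f) (T g) <-> C1_le f g].

(* Main.v *)
Require Import Defs.
From HB Require Import structures.
From mathcomp Require Import all_boot all_order all_algebra.
From mathcomp Require Import all_classical all_reals all_analysis.
From mathcomp Require Import ring lra.

Set Implicit Arguments.
Unset Strict Implicit.
Unset Printing Implicit Defensive.

Import Order.TTheory GRing.Theory Num.Theory.
Import numFieldNormedType.Exports.

Local Open Scope classical_set_scope.
Local Open Scope ring_scope.

(** A function [f] of class C1 is determined by the pair [(f 0, f')], and every
    pair made of a real number and a continuous function arises in this way
    (mean value theorem and fundamental theorem of calculus). The space thus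
    becomes the l^p-sum of the real line and [C[0,1]], with the product order,
    and the positive sphere becomes the set of the pairs [(a, u)] with
    [0 <= a], [0 <= u] and [|(a, ||u||)|_p = 1]. The claim is that a surjective
    isometry of this set has the form [(a, u) |-> (a, u \o psi)] for a
    homeomorphism [psi] of [0,1] ([pair_isoP]); such a formula obviously
    defines an isometric order isomorphism on the whole space.

    The apex [(1, 0)] is fixed, because it is characterized metrically. For
    finite [p], the largest possible distance is attained exactly between the
    apex and the pairs [(0, u)] ([diameter_fin]). For [p = +oo], two points
    with exactly one midpoint in the sphere always include the apex, because
    the unit interval is connected ([unique_midpoint_apex]). In both
    cases the apex has two different partners, so it cannot be exchanged with
    one of them ([apex_fixed_of]). Distances to the apex, and for [p = +oo]
    distances to the open unit ball around the apex, then show that the first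
    coordinate is preserved ([first_fixed]).

    On the slice [a = 0] this leaves a surjective isometry [d] of the positive
    unit sphere of [C[0,1]] ([pos_unit_isoP]). It fixes the constant 1, hence
    preserves strict positivity. A strictly positive [k] with only peak at [x]
    is sent to some [d k], and [phi x] is chosen as a peak of [d k]; comparing
    with functions that vanish only at [phi x] one sees that [d v] peaks at
    [phi x] whenever [v] is strictly positive and peaks at [x]. Applied to
    [v = min(1, u + c)] this yields [u x <= d u (phi x)]; the same inequality
    for the inverse of [d] turns it into an equality, and [phi] is a
    homeomorphism because the identity of [0,1] is in the sphere.

    Finally a function is recovered from its distances to the positive unit
    sphere ([detect_eq0]), which determines the isometry on all slices when
    [p] is finite. For [p = +oo] only [max(|a - b|, ||u - v||)] is known between
    the slices of heights [a] and [b]; that is enough as long as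
    [|a - b| <= 1/2] ([detect_eq]), so one passes from height 0 to the heights
    up to 1/2, and from height 1/2 to the remaining ones. *)

(** * Topology and calculus on the unit interval *)

Section topology_of_I01.
Context {R : realType}.
Implicit Types (x y : I01 R) (u v : I01 R -> R).

(** The inclusion of the unit interval into the reals, with a type that does
    not mention the subtype structure. *)
Definition coord01 x : R := \val x.

Lemma coord01_inj : injective coord01.
Proof. by move=> x y; exact: val_inj. Qed.

Lemma coord01P x : 0 <= coord01 x <= 1.
Proof. by rewrite /coord01; have := set_mem (valP x); rewrite /= in_itv. Qed.

Lemma clamp_subproof (t : R) :
  Num.min 1 (Num.max 0 t) \in `[0%R : R, 1%R]%classic.
Proof.
apply: mem_set; rewrite /= in_itv /=.
by rewrite ge_min lexx /= le_min ler01 le_max lexx.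
Qed.

(** The retraction of the real line onto the unit interval. Precomposition with
    it extends a function on [0,1] to the whole line. *)
Definition clamp (t : R) : I01 R :=
  exist _ (Num.min 1 (Num.max 0 t)) (clamp_subproof t).

Lemma coord01_clamp (t : R) : 0 <= t <= 1 -> coord01 (clamp t) = t.
Proof.
by move=> /andP[t0 t1]; rewrite /coord01 /= (max_idPr t0) (min_idPr t1).
Qed.

Lemma clamp_coord01 x : clamp (coord01 x) = x.
Proof. by apply: coord01_inj; rewrite coord01_clamp // coord01P. Qed.

Lemma continuous_coord01 : continuous coord01.
Proof. exact: (@initial_continuous (I01 R) R set_val). Qed.

Lemma continuous_clamp : continuous clamp.
Proof.
apply: (@continuous_comp_initial (I01 R) R R set_val) => t.
apply: (@continuous_min _ _ (cst 1) (fun t : R => Num.max 0 t)).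
  exact: cst_continuous.
by apply: continuous_max => //; exact: cst_continuous.
Qed.

(** One-sided limits at the endpoints need no special treatment here, since [y]
    only ranges over the interval. *)
Lemma cvg_dnbhs01P (F : I01 R -> R^o) x (l : R^o) :
  F y @[y --> x^'] --> l <->
  forall e, 0 < e -> exists2 d, 0 < d & forall y, y != x ->
    `|coord01 x - coord01 y| < d -> `|l - F y| < e.
Proof.
split=> [/cvgrPdist_lt H e e0|H].
  have /nbhs_ballP[d /= d0 Hd] := H e e0.
  by exists d => // y yx xy; apply: Hd.
apply/cvgrPdist_lt => e e0; have [d d0 Hd] := H e e0.
by apply/nbhs_ballP; exists d => //= y xy yx; apply: Hd.
Qed.

Lemma continuous01P (u : I01 R -> R^o) :
  (forall x e, 0 < e -> exists2 d, 0 < d & forall y,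
    `|coord01 x - coord01 y| < d -> `|u x - u y| < e) -> continuous u.
Proof.
move=> H x.
apply/(@cvgrPdist_lt R R^o (I01 R) (nbhs x) (nbhs_filter x)) => e e0.
have [d d0 Hd] := H x e e0.
by apply/nbhs_ballP; exists d => //= y xy; exact: Hd.
Qed.

Lemma continuous01_clamp u : continuous u -> continuous (u \o clamp : R -> R).
Proof.
move=> cu t; apply: continuous_comp; first exact: continuous_clamp.
exact: cu.
Qed.

Lemma EVT01 u : continuous u -> exists x, forall y, u y <= u x.
Proof.
move=> cu; have := @EVT_max R (u \o clamp) 0 1 ler01.
case; first by apply: continuous_subspaceT; exact: continuous01_clamp.
move=> c _ H; exists (clamp c) => y.
have := H (coord01 y); rewrite /= clamp_coord01; apply.
by rewrite in_itv coord01P.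
Qed.

Lemma IVT01 u (c : R) x y : continuous u -> u x <= c <= u y ->
  exists z, u z = c.
Proof.
move=> cu /andP[xc cy].
wlog : u c x y cu xc cy / coord01 x <= coord01 y.
  move=> H; have [xy|yx] := leP (coord01 x) (coord01 y).
    exact: (H u c x y).
  have [||||z] := H (\- u) (- c) y x; rewrite ?lerN2 //.
  - by move=> t; apply: continuousN; exact: cu.
  - exact: ltW.
  by move/oppr_inj; exists z.
move=> xy; have := @IVT R (u \o clamp) (coord01 x) (coord01 y) c xy.
case; first by apply: continuous_subspaceT; exact: continuous01_clamp.
  by rewrite /= !clamp_coord01 ge_min le_max xc cy orbT.
by move=> z _ zc; exists (clamp z).
Qed.

Lemma sup_norm01_le u (c : R) : (forall x, `|u x| <= c) -> sup_norm01 u <= c.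
Proof.
move=> uc; apply: ge_sup; first by exists (`|u (zero01 R)|), (zero01 R).
by move=> _ [x _ <-].
Qed.

Lemma le_sup_norm01 u x : continuous u -> `|u x| <= sup_norm01 u.
Proof.
move=> cu; have [m Hm] : exists m, forall y, `|u y| <= `|u m|.
  apply: EVT01 => t; apply: (@continuous_comp _ _ _ u Num.norm).
    exact: cu.
  exact: norm_continuous.
apply: sup_ubound; last by exists x.
by exists (`|u m|) => _ [y _ <-].
Qed.

Lemma sup_norm01_ge0 u : continuous u -> 0 <= sup_norm01 u.
Proof. by move=> cu; apply: le_trans (le_sup_norm01 (zero01 R) cu). Qed.

Lemma sup_norm01_attained u : continuous u -> exists x, sup_norm01 u = `|u x|.
Proof.
move=> cu; have [m Hm] : exists m, forall y, `|u y| <= `|u m|.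
  apply: EVT01 => t; apply: (@continuous_comp _ _ _ u Num.norm).
    exact: cu.
  exact: norm_continuous.
by exists m; apply/eqP; rewrite eq_le le_sup_norm01 // sup_norm01_le.
Qed.

End topology_of_I01.

Section calculus_on_I01.
Context {R : realType}.
Implicit Types (x y : I01 R) (f u v : I01 R -> R).

Lemma diff_quot01E f x y :
  diff_quot01 f x y = (f y - f x) / (coord01 y - coord01 x).
Proof. by []. Qed.

Lemma derivable_quotient (F : R -> R) (t l : R) :
  derivable F t 1 -> F^`()%classic t = l ->
  forall e, 0 < e -> exists2 d, 0 < d & forall s, s != t ->
    `|t - s| < d -> `|l - (F s - F t) / (s - t)| < e.
Proof.
move=> dF Fl e e0.
have : h^-1 *: (F (h *: 1 + t) - F t) @[h --> 0^'] --> l.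
  by rewrite -Fl derive1E; exact: dF.
move=> /cvgrPdist_lt/(_ e e0)/nbhs_ballP[d /= d0 Hd].
exists d => // s st ts.
have := Hd (s - t); rewrite /ball /= sub0r normrN distrC => /(_ ts).
rewrite subr_eq0 => /(_ st).
by rewrite /GRing.scale /= mulr1 subrK mulrC.
Qed.

(** The integral starts at -1, so that 0 is interior to the domain where the
    integral is differentiable. *)
Lemma continuous_primitive (G : R -> R) : continuous G ->
  exists F : R -> R,
    forall t, 0 <= t <= 1 -> derivable F t 1 /\ F^`()%classic t = G t.
Proof.
move=> cG.
exists (fun s => \int[lebesgue_measure]_(t in `[(-1)%R, s]) G t)%R => t t01.
apply: (@continuous_FTC1_closed R G (-1) t 2).
- lra.
- apply: continuous_compact_integrable; first exact: segment_compact.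
  exact: continuous_subspaceT.
- lra.
- exact: cG.
Qed.

(** An antiderivative with prescribed initial value: an integral of the
    extension [g \o clamp], restricted to the interval. *)
Lemma C1_exists (a : R) (g : I01 R -> R^o) : continuous g ->
  exists f : C1 R, f (zero01 R) = a /\ deriv01 f = g.
Proof.
move=> cg.
have [F HF] := @continuous_primitive (g \o clamp) (continuous01_clamp cg).
pose f : I01 R -> R^o := fun x => F (coord01 x) - F 0 + a.
have df x : diff_quot01 f x y @[y --> x^'] --> g x.
  apply/cvg_dnbhs01P => e e0.
  have [dF F1] := HF _ (coord01P x).
  have [d d0 Hd] := derivable_quotient dF F1 e0.
  exists d => // y yx xy; have := Hd (coord01 y).
  rewrite /= clamp_coord01 diff_quot01E /f => /(_ yx xy).
  by rewrite (_ : F (coord01 y) - F 0 + a - (F (coord01 x) - F 0 + a) =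
    F (coord01 y) - F (coord01 x)) //; ring.
have dfE : deriv01 f = g by apply/funext => x; apply: cvg_lim => //; exact: df.
have fC1 : f \in is_C1 R.
  apply: mem_set; split; last by rewrite dfE.
  by move=> x; apply/cvg_ex; exists (g x); exact: df.
by exists (MkC1 fC1); split=> //=; rewrite /f /= subrr add0r.
Qed.

Lemma deriv01_cvg (f : C1 R) x :
  diff_quot01 f x y @[y --> x^'] --> deriv01 f x.
Proof. by have [df _] := set_mem (C1_funP f); exact: df. Qed.

Lemma deriv01_continuous (f : C1 R) : continuous (deriv01 f).
Proof. by have [] := set_mem (C1_funP f). Qed.

Lemma deriv01D (f g : C1 R) : deriv01 (f + g) = deriv01 f + deriv01 g.
Proof.
have [df _] := set_mem (C1_funP f); have [dg _] := set_mem (C1_funP g).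
by have := deriv01_lin 1 df dg; rewrite !scale1r.
Qed.

Lemma deriv01Z (a : R) (f : C1 R) : deriv01 (a *: f) = a *: deriv01 f.
Proof.
have [df _] := set_mem (C1_funP f).
have [d0 _] := set_mem (C1_funP (0 : C1 R)).
have := deriv01_lin a df d0; rewrite addr0 => ->.
apply/eqP; rewrite -subr_eq0 addrC addrA addNr add0r.
have := deriv01_lin 1 d0 d0; rewrite !scale1r.
rewrite (_ : \val (0 : C1 R) + \val (0 : C1 R) = \val (0 : C1 R)); last first.
  by rewrite raddf0 addr0.
by move=> /eqP; rewrite -subr_eq0 opprD addrA subrr sub0r oppr_eq0.
Qed.

Lemma deriv01B (f g : C1 R) : deriv01 (f - g) = deriv01 f - deriv01 g.
Proof. by rewrite -scaleN1r deriv01D deriv01Z scaleN1r. Qed.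

Lemma C1_continuous (f : C1 R) : continuous (f : I01 R -> R^o).
Proof.
apply: continuous01P => x e e0.
have [d d0 Hd] := (cvg_dnbhs01P _ _ _).1 (@deriv01_cvg f x) 1 ltr01.
pose M := `|deriv01 f x| + 1.
have M0 : 0 < M by rewrite ltr_wpDl.
exists (Num.min d (e / M)).
  by rewrite lt_min d0 divr_gt0.
move=> y; rewrite lt_min => /andP[xyd xye].
have [->|yx] := eqVneq y x; first by rewrite subrr normr0.
have := Hd y yx xyd; rewrite diff_quot01E => H.
have yx0 : coord01 y - coord01 x != 0 by rewrite subr_eq0.
have {}H : `|(f y - f x) / (coord01 y - coord01 x)| < M.
  rewrite (le_lt_trans _ (_ : `|deriv01 f x| + `|deriv01 f x -
    (f y - f x) / (coord01 y - coord01 x)| < M)) ?ltrD2l //.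
  by rewrite -[X in `|X| <= _](subKr (deriv01 f x)) (le_trans (ler_normB _ _)).
rewrite distrC; have -> : f y - f x =
    (f y - f x) / (coord01 y - coord01 x) * (coord01 y - coord01 x).
  by rewrite divfK.
rewrite normrM [`|coord01 y - _|]distrC.
by rewrite (lt_le_trans (ltr_pM _ _ H xye)) // mulrC divfK // gt_eqF.
Qed.

Lemma C1_const (f : C1 R) : (forall x, deriv01 f x = 0) ->
  forall x, f x = f (zero01 R).
Proof.
move=> f'0 x; have [x0|x0] := eqVneq x (zero01 R); first by rewrite x0.
pose F : R -> R := f \o clamp.
have xgt0 : 0 < coord01 x.
  rewrite lt_neqAle; have /andP[-> _] := coord01P x; rewrite eq_sym andbT.
  by apply: contra_neq x0 => x0; apply: coord01_inj.
have dF t : t \in `]0, coord01 x[ -> is_derive t (1:R) F 0.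
  rewrite in_itv /= => /andP[t0 tx].
  have x1 : coord01 x <= 1 by have /andP[] := coord01P x.
  have t01 : 0 <= t <= 1 by rewrite ltW /= ?(ltW (lt_le_trans tx x1)).
  have t1 : t < 1 := lt_le_trans tx x1.
  have : h^-1 *: (F (h *: 1 + t) - F t) @[h --> 0^'] --> (0 : R).
    apply/cvgrPdist_lt => e e0.
    have [d d0 Hd] := (cvg_dnbhs01P _ _ _).1 (@deriv01_cvg f (clamp t)) e e0.
    apply/nbhs_ballP; exists (Num.min d (Num.min t (1 - t))).
      by rewrite /= !lt_min d0 t0 subr_gt0.
    move=> h; rewrite /ball /= sub0r normrN !lt_min => /and3P[hd ht ht1] h0.
    have th : 0 <= h + t <= 1.
      move: ht ht1; rewrite !ltr_norml => /andP[? ?] /andP[? ?].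
      by apply/andP; split; lra.
    have := Hd (clamp (h + t)); rewrite f'0 diff_quot01E !coord01_clamp // => H.
    rewrite /GRing.scale /= mulr1 mulrC -{2}(addrK t h); apply: H.
      apply: contra_neq h0 => /(congr1 coord01).
      by rewrite !coord01_clamp // => ?; lra.
    by rewrite opprD addrCA subrr addr0 normrN.
  move=> cF; split; first by apply/cvg_ex; exists 0.
  by apply: cvg_lim cF.
have cF : {within `[0, coord01 x], continuous F}.
  apply: continuous_subspaceT; apply: continuous01_clamp.
  exact: C1_continuous.
have [c _] := @MVT R F (fun=> 0) 0 (coord01 x) xgt0 dF cF.
rewrite mul0r /F /= clamp_coord01 => /eqP; rewrite subr_eq0 => /eqP ->.
by congr (f _); apply: coord01_inj; rewrite coord01_clamp // lexx ler01.
Qed.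

Lemma C1_eq (f g : C1 R) : f (zero01 R) = g (zero01 R) ->
  deriv01 f = deriv01 g -> f = g.
Proof.
move=> fg0 fg'; apply: val_inj; apply/funext => x.
have := @C1_const (f - g) _ x.
rewrite deriv01B fg' /= => /(_ (fun=> subrr _)).
by rewrite !fctE /= fg0 subrr => /eqP; rewrite subr_eq0 => /eqP.
Qed.

End calculus_on_I01.

(** * Surjective isometries of the positive unit sphere of C[0,1] *)

Section continuity_rules.
Context {R : realType}.
Implicit Types (u v : I01 R -> R).

Lemma cont_cst (c : R) : continuous ((fun=> c) : I01 R -> R).
Proof. exact: cst_continuous. Qed.

Lemma contD u v : continuous u -> continuous v ->
  continuous (fun x => u x + v x).
Proof.
by move=> cu cv x; apply: (@continuousD R R^o _ u v); [exact: cu|exact: cv].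
Qed.

Lemma contN u : continuous u -> continuous (fun x => - u x).
Proof. by move=> cu x; apply: (@continuousN R R^o _ u); exact: cu. Qed.

Lemma contB u v : continuous u -> continuous v ->
  continuous (fun x => u x - v x).
Proof. by move=> cu cv; apply: contD => //; exact: contN. Qed.

Lemma contZ (c : R) u : continuous u -> continuous (fun x => c * u x).
Proof.
move=> cu x; apply: (@continuousM _ _ (fun=> c) u); last exact: cu.
exact: cst_continuous.
Qed.

Lemma cont_norm u : continuous u -> continuous (fun x => `|u x|).
Proof.
move=> cu x; apply: (@continuous_comp _ _ _ u Num.norm); first exact: cu.
exact: norm_continuous.
Qed.

Lemma cont_min u v : continuous u -> continuous v ->
  continuous (fun x => Num.min (u x) (v x)).
Proof. by move=> cu cv x; apply: continuous_min; [exact: cu|exact: cv]. Qed.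

Lemma cont_max u v : continuous u -> continuous v ->
  continuous (fun x => Num.max (u x) (v x)).
Proof. by move=> cu cv x; apply: continuous_max; [exact: cu|exact: cv]. Qed.

Lemma cont_comp (f : I01 R -> I01 R) u : continuous f -> continuous u ->
  continuous (u \o f).
Proof. by move=> cf cu x; apply: continuous_comp; [exact: cf|exact: cu]. Qed.

End continuity_rules.
Arguments cont_cst {R} c.

#[local] Hint Resolve cont_cst contD contN contB contZ cont_norm cont_min
  cont_max continuous_coord01 : core.

Section sup_distance.
Context {R : realType}.
Implicit Types (u v w : I01 R -> R) (x y : I01 R).

(** The supremum distance of two functions on [0,1]. *)
Definition dst u v : R := sup_norm01 (fun x => u x - v x).

Lemma dst_le u v (c : R) : (forall x, `|u x - v x| <= c) -> dst u v <= c.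
Proof. exact: sup_norm01_le. Qed.

Lemma le_dst u v x : continuous u -> continuous v -> `|u x - v x| <= dst u v.
Proof.
move=> cu cv.
exact: (@le_sup_norm01 _ (fun t => u t - v t) x (contB cu cv)).
Qed.

Lemma dst_attained u v : continuous u -> continuous v ->
  exists x, dst u v = `|u x - v x|.
Proof.
move=> cu cv.
exact: (@sup_norm01_attained _ (fun t => u t - v t) (contB cu cv)).
Qed.

Lemma dstC u v : dst u v = dst v u.
Proof.
rewrite /dst /sup_norm01; congr (sup _).
by apply: eq_imagel => x _; rewrite distrC.
Qed.

Lemma dst_ge0 u v : continuous u -> continuous v -> 0 <= dst u v.
Proof. by move=> cu cv; apply: sup_norm01_ge0; exact: contB. Qed.

(** The positive unit sphere of C[0,1]. The norm condition is stated as the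
    attainment of the value 1. *)
Definition pos_unit u : Prop :=
  [/\ continuous u, forall x, 0 <= u x <= 1 & exists x, u x = 1].

Lemma pos_unit1 : pos_unit (fun=> 1).
Proof. by split=> // [x|]; [rewrite ler01 lexx|exists (zero01 R)]. Qed.

Lemma pos_unit_coord01 : pos_unit (coord01 : I01 R -> R).
Proof.
split=> [|x|]; [exact: continuous_coord01|exact: coord01P|exists (clamp 1)].
by rewrite coord01_clamp // ler01 lexx.
Qed.

(** Strictly positive, with only peak at [x]. *)
Lemma pos_unit_tent x : pos_unit (fun t => 1 - 2^-1 * `|coord01 t - coord01 x|).
Proof.
split=> [|t|]; first by auto 6.
  have := coord01P t; have := coord01P x.
  case: (lerP (coord01 t) (coord01 x)); lra.
by exists x; rewrite subrr normr0 mulr0 subr0.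
Qed.

(** Vanishes exactly at [x]; it reaches 1 because one of the endpoints has
    distance at least 1/2 from [x]. *)
Lemma pos_unit_well x :
  pos_unit (fun t => Num.min 1 (2 * `|coord01 t - coord01 x|)).
Proof.
split=> [|t|]; first by auto 6.
  by rewrite ge_min lexx le_min ler01 /= mulr_ge0.
have x01 := coord01P x; have [h|h] := lerP (coord01 x) 2^-1.
  exists (clamp 1); rewrite coord01_clamp ?ler01 ?lexx //; apply/min_idPl.
  by rewrite ger0_norm; lra.
exists (clamp 0); rewrite coord01_clamp ?ler01 ?lexx //; apply/min_idPl.
by rewrite ler0_norm; lra.
Qed.

Lemma pos_unit_lift u (c : R) x : continuous u -> (forall t, 0 <= u t <= 1) ->
  0 <= c -> 1 <= u x + c -> pos_unit (fun t => Num.min 1 (u t + c)).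
Proof.
move=> cu u01 c0 xc; split=> [|t|]; first by auto 6.
  have /andP[u0 u1] := u01 t.
  by rewrite ge_min lexx le_min ler01 addr_ge0.
by exists x; apply/min_idPl.
Qed.

Lemma dst_lift u (c : R) : (forall t, 0 <= u t <= 1) -> 0 <= c ->
  dst u (fun t => Num.min 1 (u t + c)) <= c.
Proof.
move=> u01 c0; apply: dst_le => t; have /andP[u0 u1] := u01 t.
by rewrite ler_norml; case: (leP 1 (u t + c)) => ?; apply/andP; split; lra.
Qed.

(** [d] is a surjective isometry of the positive unit sphere of C[0,1], with
    inverse [e]; the values of [d] and [e] elsewhere do not matter. *)
Definition pos_unit_iso (d e : (I01 R -> R) -> (I01 R -> R)) : Prop :=
  [/\ forall u, pos_unit u -> pos_unit (d u),
      forall u, pos_unit u -> pos_unit (e u),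
      forall u, pos_unit u -> e (d u) = u,
      forall u, pos_unit u -> d (e u) = u &
      forall u v, pos_unit u -> pos_unit v -> dst (d u) (d v) = dst u v].

Lemma pos_unit_isoC d e : pos_unit_iso d e -> pos_unit_iso e d.
Proof.
move=> [dS eS ed de dI]; split=> // u v Su Sv.
by rewrite -dI ?de //; apply: eS.
Qed.

(** A metric characterization of the constant 1: balls around it have a diameter
    at most equal to their radius. Around any other [u], a function with a value
    in ]0,1[ by connectedness, [u + g] and [u - g] with [g = min(1 - u, u)] are
    twice as far from each other as from [u]. *)
Lemma pos_unit_eq1P u : pos_unit u ->
  (u = fun=> 1) <-> forall v w, pos_unit v -> pos_unit w ->
    dst v w <= Num.max (dst u v) (dst u w).
Proof.
move=> [cu u01 [y uy]]; split=> [-> v w [cv v01 _] [cw w01 _]|H].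
  apply: dst_le => x; have /andP[v0 v1] := v01 x; have /andP[w0 w1] := w01 x.
  rewrite le_max; have [vw|vw] := lerP (v x) (w x); apply/orP; [left|right].
    by apply: le_trans (@le_dst (fun=> 1) v x (cont_cst 1) cv);
      rewrite ger0_norm; lra.
  by apply: le_trans (@le_dst (fun=> 1) w x (cont_cst 1) cw);
      rewrite ger0_norm; lra.
apply/funext => x; apply/eqP; apply/negPn/negP => ux.
have /andP[ux0 ux1] := u01 x.
have {}ux1 : u x < 1 by rewrite lt_neqAle ux.
pose g t := Num.min (1 - u t) (u t).
have cg : continuous g by rewrite /g; auto.
(* The perturbation is tested at a maximum of [g], where it is as large as the
   radius of the ball; at the peak [y] it vanishes, so the norm stays 1. *)
have [z gz] := EVT01 cg.
have gz0 : 0 < g z.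
  have [|s us] := @IVT01 _ u ((u x + 1) / 2) x y cu; first by rewrite uy; lra.
  by apply: lt_le_trans (gz s); rewrite /g us lt_min; lra.
have gy : g y = 0 by rewrite /g uy subrr; apply/min_idPl; rewrite ler01.
have g01 t : 0 <= g t /\ g t <= u t /\ g t <= 1 - u t.
  have := u01 t; rewrite /g; case: (leP (1 - u t) (u t)); lra.
have Sv : pos_unit (fun t => u t + g t).
  split=> [|t|]; [by auto|by have := u01 t; have := g01 t; lra|].
  by exists y; rewrite uy gy addr0.
have Sw : pos_unit (fun t => u t - g t).
  split=> [|t|]; [by auto|by have := u01 t; have := g01 t; lra|].
  by exists y; rewrite uy gy subr0.
have dv : dst u (fun t => u t + g t) <= g z.
  apply: dst_le => t; rewrite opprD addrA subrr sub0r normrN ger0_norm //.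
  by have [] := g01 t.
have dw : dst u (fun t => u t - g t) <= g z.
  apply: dst_le => t; rewrite opprB addrC subrK ger0_norm //.
  by have [] := g01 t.
have := H _ _ Sv Sw; rewrite leNgt => /negP; apply.
apply: (@le_lt_trans _ _ (g z)); first by rewrite ge_max dv dw.
have [cv _ _] := Sv; have [cw _ _] := Sw.
apply: lt_le_trans (le_dst z cv cw).
by rewrite ger0_norm; lra.
Qed.

Lemma pos_unit_iso1 d e : pos_unit_iso d e -> d (fun=> 1) = fun=> 1.
Proof.
move=> [dS eS ed de dI]; apply/(pos_unit_eq1P (dS _ pos_unit1)) => v w Sv Sw.
have := (pos_unit_eq1P pos_unit1).1 erefl _ _ (eS _ Sv) (eS _ Sw).
have S1 := pos_unit1; have Sev := eS _ Sv; have Sew := eS _ Sw.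
by rewrite -(dI _ _ Sev Sew) -(dI _ _ S1 Sev) -(dI _ _ S1 Sew) !de.
Qed.

Lemma dst1_lt1 u : pos_unit u -> dst (fun=> 1) u < 1 <-> forall x, 0 < u x.
Proof.
move=> [cu u01 _]; split=> [H x|u0].
  have := le_lt_trans (@le_dst (fun=> 1) u x (cont_cst 1) cu) H.
  by have := u01 x; move=> /andP[? ?]; rewrite ger0_norm; lra.
have [x ->] := dst_attained (cont_cst 1) cu.
by have := u0 x; have := u01 x; move=> /andP[? ?] ?; rewrite ger0_norm; lra.
Qed.

(** The maximal distance is attained where a peak meets a zero. *)
Lemma dst_eq1P u v : pos_unit u -> pos_unit v -> dst u v = 1 <->
  exists x, (u x = 1 /\ v x = 0) \/ (u x = 0 /\ v x = 1).
Proof.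
move=> [cu u01 _] [cv v01 _]; split=> [|[x]].
  have [x ->] := dst_attained cu cv => uv; exists x; move: uv.
  have := u01 x; have := v01 x; case: (lerP (u x) (v x)) => ? ? ? ?.
    by right; split; lra.
  by left; split; lra.
move=> H; apply/eqP; rewrite eq_le; apply/andP; split.
  apply: dst_le => t; have := u01 t; have := v01 t => /andP[? ?] /andP[? ?].
  by rewrite ler_norml; apply/andP; split; lra.
apply: le_trans (le_dst x cu cv).
by case: H => -[-> ->]; rewrite ?subr0 ?sub0r ?normrN normr1.
Qed.

(** The point map [phi]: [y] is a peak of the image of the tent [k] at [x].
    Since [z] vanishes only at [y], the function [e z] is at distance 1 from
    [k], hence vanishes at [x]; so every positive [v] with peak [x] is at
    distance 1 from [e z], and [d v] has a peak at the only zero [y] of [z]. *)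
Lemma pos_unit_iso_transfer d e : pos_unit_iso d e ->
  forall x, exists y, forall u, pos_unit u -> u x <= d u y.
Proof.
move=> iso x; have [dS eS ed de dI] := iso.
have d1 := pos_unit_iso1 iso.
have dpos u : pos_unit u -> (forall t, 0 < u t) -> forall t, 0 < d u t.
  move=> Su /(dst1_lt1 Su) u0; apply/(dst1_lt1 (dS _ Su)).
  by rewrite -d1 dI //; exact: pos_unit1.
pose k t := 1 - 2^-1 * `|coord01 t - coord01 x|.
have Sk : pos_unit k := pos_unit_tent x.
have k0 t : 0 < k t.
  have := coord01P t; have := coord01P x; rewrite /k.
  case: (lerP (coord01 t) (coord01 x)); lra.
have kx t : k t = 1 -> t = x.
  rewrite /k => kt; apply: coord01_inj; apply/eqP.
  rewrite -subr_eq0 -normr_eq0; apply/eqP; lra.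
have [_ _ [y dky]] := dS _ Sk; exists y.
pose z t := Num.min 1 (2 * `|coord01 t - coord01 y|).
have Sz : pos_unit z := pos_unit_well y.
have zy : z y = 0.
  by rewrite /z subrr normr0 mulr0; apply/min_idPr; rewrite ler01.
have z0 t : z t = 0 -> t = y.
  rewrite /z => zt; apply: coord01_inj; apply/eqP.
  rewrite -subr_eq0 -normr_eq0; apply/eqP; move: zt.
  by case: leP => ? ?; lra.
have ezx : e z x = 0.
  have : dst (e z) k = 1.
    rewrite -dI ?de //; last exact: eS.
    by apply/dst_eq1P => //; [exact: dS|exists y; right].
  move=> /dst_eq1P -/(_ (eS _ Sz) Sk)[t [[_ kt]|[ezt /kx <-]]] //.
  by have := k0 t; rewrite kt ltxx.
have peak v : pos_unit v -> (forall t, 0 < v t) -> v x = 1 -> d v y = 1.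
  move=> Sv v0 vx.
  have : dst z (d v) = 1.
    rewrite -(de z) // dI //; last exact: eS.
    by apply/dst_eq1P => //; [exact: eS|exists x; right].
  move=> /dst_eq1P -/(_ Sz (dS _ Sv))[t [[_ dvt]|[/z0 -> //]]].
  by have := dpos v Sv v0 t; rewrite dvt ltxx.
move=> u Su; have [cu u01 _] := Su; apply/ler_addgt0Pl => c c0.
have /andP[ux0 ux1] := u01 x.
(* A little more than [1 - u x], which keeps the lifted function strictly
   positive even when [u x = 1]. *)
pose c' := 1 - u x + c.
have c'0 : 0 < c' by rewrite /c'; lra.
pose v t := Num.min 1 (u t + c').
have Sv : pos_unit v.
  by apply: (pos_unit_lift (x := x)); rewrite ?ltW // /c'; lra.
have dvy : d v y = 1.
  apply: peak => // [t|].
    by rewrite /v lt_min ltr01; have := u01 t => /andP[? ?]; lra.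
  by apply/min_idPl; rewrite /c'; lra.
have := dst_lift u01 (ltW c'0); rewrite -dI // => H.
have [cdu _ _] := dS _ Su; have [cdv _ _] := dS _ Sv.
have := le_trans (le_dst y cdu cdv) H.
by rewrite dvy ler_norml => /andP[+ _]; rewrite /c'; lra.
Qed.

(** The sphere is moved by composition with a homeomorphism. *)
Theorem pos_unit_isoP d e : pos_unit_iso d e ->
  exists phi psi : I01 R -> I01 R,
    [/\ continuous phi, continuous psi, cancel phi psi, cancel psi phi &
        forall u, pos_unit u -> d u = u \o psi].
Proof.
move=> iso; have iso' := pos_unit_isoC iso; have [dS eS ed de dI] := iso.
have [phi Hphi] := choice (pos_unit_iso_transfer iso).
have [psi Hpsi] := choice (pos_unit_iso_transfer iso').
have tentK x y : (1 <= 1 - 2^-1 * `|coord01 y - coord01 x|) -> y = x.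
  move=> H; apply: coord01_inj; apply/eqP; rewrite -subr_eq0 -normr_eq0 eq_le.
  by rewrite normr_ge0 andbT; lra.
have phiK : cancel phi psi.
  move=> x; apply: tentK.
  have S := pos_unit_tent x.
  have := le_trans (Hphi x _ S) (Hpsi (phi x) _ (dS _ S)).
  by rewrite ed // subrr normr0 mulr0 subr0.
have psiK : cancel psi phi.
  move=> x; apply: tentK.
  have S := pos_unit_tent x.
  have := le_trans (Hpsi x _ S) (Hphi (psi x) _ (eS _ S)).
  by rewrite de // subrr normr0 mulr0 subr0.
have dE u : pos_unit u -> d u = u \o psi.
  move=> Su; apply/funext => y /=; apply/eqP; rewrite eq_le.
  have := Hphi (psi y) _ Su; rewrite psiK => ->.
  by have := Hpsi y _ (dS _ Su); rewrite ed // => ->.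
have eE u : pos_unit u -> e u = u \o phi.
  move=> Su; rewrite -[in RHS](de u) // dE; last exact: eS.
  by apply/funext => y /=; rewrite phiK.
exists phi, psi; split=> //.
- apply: (@continuous_comp_initial (I01 R) (I01 R) R set_val).
  have [+ _ _] := eS _ pos_unit_coord01.
  by rewrite eE //; exact: pos_unit_coord01.
- apply: (@continuous_comp_initial (I01 R) (I01 R) R set_val).
  have [+ _ _] := dS _ pos_unit_coord01.
  by rewrite dE //; exact: pos_unit_coord01.
Qed.

End sup_distance.

(** * Recovering a function from its distances to the positive unit sphere *)

Section sup_distance_extra.
Context {R : realType}.
Implicit Types (u v w : I01 R -> R).

Lemma dst0 u : dst (fun=> 0) u = sup_norm01 u.
Proof.
rewrite /dst /sup_norm01; congr (sup _).
by apply: eq_imagel => x _; rewrite sub0r normrN.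
Qed.

Lemma sup_norm01_cst (c : R) : 0 <= c ->
  sup_norm01 ((fun=> c) : I01 R -> R) = c.
Proof.
move=> c0; have [x ->] := sup_norm01_attained (cont_cst c).
by rewrite ger0_norm.
Qed.

Lemma pos_unitE u : pos_unit u <->
  [/\ continuous u, forall x, 0 <= u x & sup_norm01 u = 1].
Proof.
split=> [[cu u01 [y uy]]|[cu u0 u1]]; split=> //.
- by move=> x; have /andP[] := u01 x.
- apply/eqP; rewrite eq_le; apply/andP; split.
    by apply: sup_norm01_le => x; have /andP[? ?] := u01 x; rewrite ger0_norm.
  by have := le_sup_norm01 y cu; rewrite uy normr1.
- move=> x; rewrite u0 -u1 /=.
  by apply: le_trans (le_sup_norm01 x cu); exact: ler_norm.
- have [y uy] := sup_norm01_attained cu; exists y.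
  by rewrite -(ger0_norm (u0 y)) -uy.
Qed.

Lemma dst_comp (f g : I01 R -> I01 R) u v : continuous u -> continuous v ->
  continuous f -> cancel g f -> dst (u \o f) (v \o f) = dst u v.
Proof.
move=> cu cv cf gK.
have cuf := cont_comp cf cu.
have cvf := cont_comp cf cv.
apply/eqP; rewrite eq_le; apply/andP; split; apply: dst_le => x.
  exact: (le_dst (f x) cu cv).
by have := le_dst (g x) cuf cvf; rewrite /= gK.
Qed.

Lemma pos_unit_comp (f g : I01 R -> I01 R) u : continuous f -> cancel g f ->
  pos_unit u -> pos_unit (u \o f).
Proof.
move=> cf gK [cu u01 [y uy]]; split=> [|x|].
- exact: cont_comp.
- exact: u01.
- by exists (g y); rewrite /= gK.
Qed.

(** Tested on [v = min(1, u + (1 - u x))], which equals 1 at [x] and is at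
    distance at most [1 - u x] from [u]. *)
Lemma lower_detect u w (c : R) : continuous u -> continuous w ->
  (forall t, 0 <= u t <= 1) ->
  (forall v, pos_unit v -> Num.max c (dst w v) <= Num.max c (dst u v)) ->
  forall x, Num.min (1 - c) (u x) <= w x.
Proof.
move=> cu cw u01 H x; have /andP[ux0 ux1] := u01 x.
have s0 : 0 <= 1 - u x by rewrite subr_ge0.
pose v t := Num.min 1 (u t + (1 - u x)).
have vx : v x = 1 by rewrite /v addrC subrK; exact/min_idPl.
have Sv : pos_unit v by apply: (pos_unit_lift (x := x)) => //; lra.
have [cv _ _] := Sv.
have := le_trans (le_dst x cw cv) (le_trans _ (H v Sv)).
rewrite le_max lexx orbT vx => /(_ isT) {}H.
have {}H : `|w x - 1| <= Num.max c (1 - u x).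
  by apply: le_trans H _; rewrite ge_max !le_max lexx (dst_lift u01 s0) orbT.
move: H; rewrite ler_norml ge_min => /andP[+ _].
by case: (leP c (1 - u x)) => _ ?; apply/orP; [right|left]; lra.
Qed.

(** Tested on a [v <= u] with [v x = 0], with [v y = u y = 1] at a peak [y] of
    [u], and at distance at most [u x] from [u]. *)
Lemma upper_detect u w (c : R) : pos_unit u -> pos_unit w ->
  (forall v, pos_unit v -> Num.max c (dst w v) <= Num.max c (dst u v)) ->
  forall x, w x <= Num.max c (u x).
Proof.
move=> [cu u01 [y uy]] [cw w01 _] H x; have /andP[ux0 ux1] := u01 x.
have /andP[wx0 wx1] := w01 x.
have [uxE|uxN1] := eqVneq (u x) 1; first by rewrite uxE le_max wx1 orbT.
have xy0 : `|coord01 x - coord01 y| != 0.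
  apply: contra_neq uxN1 => /eqP; rewrite normr_eq0 subr_eq0 => /eqP xy.
  by rewrite (coord01_inj xy).
pose k := `|coord01 x - coord01 y|^-1.
pose g t := Num.min (u x) (k * `|coord01 t - coord01 y|).
have g0 t : 0 <= g t <= u x.
  by rewrite /g le_min ux0 mulr_ge0 ?invr_ge0 //= ge_min lexx.
have gx : g x = u x by rewrite /g mulVf //; exact/min_idPl.
have gy : g y = 0 by rewrite /g subrr normr0 mulr0; exact/min_idPr.
(* [g] removes [u x] from [u] at [x] and nothing at the peak [y]. *)
pose v t := Num.max 0 (u t - g t).
have Sv : pos_unit v.
  split=> [|t|].
  - by rewrite /v /g; auto 8.
  - have := u01 t; have := g0 t; rewrite /v; case: (leP 0 (u t - g t)); lra.
  - by exists y; rewrite /v uy gy subr0; apply/max_idPr; rewrite ler01.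
have vx : v x = 0 by rewrite /v gx subrr; apply/max_idPl.
have [cv _ _] := Sv.
have duv : dst u v <= u x.
  apply: dst_le => t; rewrite ler_norml; have := u01 t; have := g0 t.
  by rewrite /v; case: (leP 0 (u t - g t)); lra.
have := le_trans (le_dst x cw cv) (le_trans _ (H v Sv)).
rewrite le_max lexx orbT vx subr0 ger0_norm // => /(_ isT) {}H.
by apply: le_trans H _; rewrite ge_max !le_max lexx duv orbT.
Qed.

(** Distances smaller than [c] may be unknown. The bounds of [lower_detect] and
    [upper_detect], with [u] and [w] in both roles, leave no gap exactly when
    [c <= 1 - c]. *)
Lemma detect_eq u w (c : R) : pos_unit u -> pos_unit w -> c <= 2^-1 ->
  (forall v, pos_unit v -> Num.max c (dst w v) = Num.max c (dst u v)) -> w = u.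
Proof.
move=> Su Sw c2 H; have [cu u01 _] := Su; have [cw w01 _] := Sw.
apply/funext => x.
have h1 := @lower_detect u w c cu cw u01 _ x.
have h2 := @lower_detect w u c cw cu w01 _ x.
have h3 := @upper_detect u w c Su Sw _ x.
have h4 := @upper_detect w u c Sw Su _ x.
have {}h1 : Num.min (1 - c) (u x) <= w x by apply: h1 => v Sv; rewrite H.
have {}h2 : Num.min (1 - c) (w x) <= u x by apply: h2 => v Sv; rewrite H.
have {}h3 : w x <= Num.max c (u x) by apply: h3 => v Sv; rewrite H.
have {}h4 : u x <= Num.max c (w x) by apply: h4 => v Sv; rewrite H.
move: h1 h2 h3 h4.
by case: (leP (1 - c) (u x)); case: (leP (1 - c) (w x));
  case: (leP c (u x)); case: (leP c (w x)); lra.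
Qed.

(** When all distances are known, [u] and [w] need not have norm 1. *)
Lemma detect_eq0 u w : continuous u -> continuous w ->
  (forall t, 0 <= u t <= 1) -> (forall t, 0 <= w t <= 1) ->
  (forall v, pos_unit v -> dst w v = dst u v) -> w = u.
Proof.
move=> cu cw u01 w01 H; apply/funext => x; apply/eqP; rewrite eq_le.
have h1 := @lower_detect u w 0 cu cw u01 _ x.
have h2 := @lower_detect w u 0 cw cu w01 _ x.
have {}h1 : Num.min (1 - 0) (u x) <= w x by apply: h1 => v Sv; rewrite H.
have {}h2 : Num.min (1 - 0) (w x) <= u x by apply: h2 => v Sv; rewrite H.
move: h1 h2; have /andP[_ u1] := u01 x; have /andP[_ w1] := w01 x.
by rewrite !subr0 (min_idPr u1) (min_idPr w1) => -> ->.
Qed.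

End sup_distance_extra.

(** * The positive sphere of the l^p-sum of R and C[0,1] *)

Section pairs.
Context {R : realType}.
Implicit Types (p : \bar R) (r a b : R) (u v w : I01 R -> R).

(** The l^p-norm on the nonnegative quadrant; the value at [-oo] is junk. *)
Definition lpn p a b : R :=
  match p with
  | r%:E => (a `^ r + b `^ r) `^ r^-1
  | +oo%E => Num.max a b
  | -oo%E => 0
  end.

Lemma lpn_finK r a b : 1 <= r -> (lpn r%:E a b) `^ r = a `^ r + b `^ r.
Proof.
move=> r1; have r0 : r != 0 by rewrite gt_eqF // (lt_le_trans ltr01).
by rewrite /lpn -powRrM mulVf // powRr1 // addr_ge0 ?powR_ge0.
Qed.

Lemma powR_inj_nneg r a b : 1 <= r -> 0 <= a -> 0 <= b ->
  a `^ r = b `^ r -> a = b.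
Proof.
move=> r1 a0 b0 /(congr1 (fun z => z `^ r^-1)).
have r0 : r != 0 by rewrite gt_eqF // (lt_le_trans ltr01).
by rewrite -!powRrM mulfV // !powRr1.
Qed.

Lemma lpn0l p b : (1 <= p)%E -> 0 <= b -> lpn p 0 b = b.
Proof.
case: p => [r||] //= ; last by move=> _ b0; exact/max_idPr.
rewrite lee_fin => r1 b0.
have r0 : r != 0 by rewrite gt_eqF // (lt_le_trans ltr01).
by rewrite powR0 // add0r -powRrM mulfV // powRr1.
Qed.

Lemma lpn0r p a : (1 <= p)%E -> 0 <= a -> lpn p a 0 = a.
Proof.
case: p => [r||] //= ; last by move=> _ b0; exact/max_idPl.
rewrite lee_fin => r1 b0.
have r0 : r != 0 by rewrite gt_eqF // (lt_le_trans ltr01).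
by rewrite powR0 // addr0 -powRrM mulfV // powRr1.
Qed.

Local Notation pair := (R * (I01 R -> R))%type.
Implicit Types (x y m : pair).

(** The positive part of the unit sphere of the l^p-sum of R and C[0,1]. *)
Definition pair_sphere p x : Prop :=
  [/\ continuous x.2, 0 <= x.1, forall t, 0 <= x.2 t &
      lpn p x.1 (sup_norm01 x.2) = 1].

(** The distance of the l^p-sum. *)
Definition pair_dst p x y : R := lpn p `|x.1 - y.1| (dst x.2 y.2).

Lemma pair_dst_finK r x y : 1 <= r ->
  pair_dst r%:E x y `^ r = `|x.1 - y.1| `^ r + dst x.2 y.2 `^ r.
Proof. exact: lpn_finK. Qed.

Lemma lpn_fin11 r : 1 <= r -> lpn r%:E 1 1 `^ r = 2.
Proof. by move=> r1; rewrite lpn_finK // powR1. Qed.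

(** The point of the sphere that corresponds to the constant function 1. *)
Definition apex : pair := (1, fun=> 0).

Lemma pair_dstE p x y : pair_dst p x y = lpn p `|x.1 - y.1| (dst x.2 y.2).
Proof. by []. Qed.

Lemma pair_dstC p x y : pair_dst p x y = pair_dst p y x.
Proof. by rewrite /pair_dst distrC dstC. Qed.

Lemma pair_sphere_apex p : (1 <= p)%E -> pair_sphere p apex.
Proof.
by move=> p1; split=> //=; rewrite ?sup_norm01_cst ?lpn0r.
Qed.

Lemma pair_sphere_slice0 p u : (1 <= p)%E ->
  pair_sphere p (0, u) <-> pos_unit u.
Proof.
move=> p1; rewrite pos_unitE; split=> [[/= cu _ u0]|[cu u0 u1]].
  by rewrite lpn0l //; exact: sup_norm01_ge0.
by split=> //=; rewrite lpn0l // u1.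
Qed.

Lemma pair_sphere_le1 p x : (1 <= p)%E -> pair_sphere p x ->
  x.1 <= 1 /\ sup_norm01 x.2 <= 1.
Proof.
move=> p1 [cu a0 u0]; have n0 := sup_norm01_ge0 cu.
case: p p1 => [r||] //; last first.
  by move=> _ /= <-; rewrite !le_max !lexx orbT.
rewrite lee_fin => r1 /(congr1 (fun z => z `^ r)).
rewrite (lpn_finK _ _ r1) powR1 => H.
have h z : 0 <= z -> z `^ r <= 1 -> z <= 1.
  move=> z0 zr; rewrite leNgt; apply/negP => z1.
  have : 1 `^ r < z `^ r.
    by rewrite gt0_ltr_powR // ?nnegrE // (lt_le_trans ltr01).
  by rewrite powR1 ltNge zr.
have := powR_ge0 x.1 r; have := powR_ge0 (sup_norm01 x.2) r => h1 h2.
by split; apply: h => //; lra.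
Qed.

Lemma pair_sphere_bound p x : (1 <= p)%E -> pair_sphere p x ->
  forall t, 0 <= x.2 t <= 1.
Proof.
move=> p1 Sx t; have [_ n1] := pair_sphere_le1 p1 Sx; have [cu _ u0 _] := Sx.
rewrite u0 /=; apply: le_trans n1; apply: le_trans (le_sup_norm01 t cu).
exact: ler_norm.
Qed.

Lemma sup_norm01_eq0 u : continuous u -> sup_norm01 u = 0 -> u = fun=> 0.
Proof.
move=> cu u0; apply/funext => t; apply/eqP; rewrite -normr_eq0 eq_le normr_ge0.
by rewrite andbT -u0 le_sup_norm01.
Qed.

(** [d] is a surjective isometry of the positive sphere, with inverse [e]; the
    values of [d] and [e] elsewhere do not matter. *)
Definition pair_iso p (d e : pair -> pair) : Prop :=
  [/\ forall x, pair_sphere p x -> pair_sphere p (d x),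
      forall x, pair_sphere p x -> pair_sphere p (e x),
      forall x, pair_sphere p x -> e (d x) = x,
      forall x, pair_sphere p x -> d (e x) = x &
      forall x y, pair_sphere p x -> pair_sphere p y ->
        pair_dst p (d x) (d y) = pair_dst p x y].

Lemma pair_isoC p d e : pair_iso p d e -> pair_iso p e d.
Proof.
move=> [dS eS ed de dI]; split=> // u v Su Sv.
by rewrite -dI ?de //; apply: eS.
Qed.

(** A relation that is invariant under [d] and only holds for pairs containing
    the apex: if [d] moved the apex, both partners [y1] and [y2] would be sent
    to it. *)
Lemma apex_fixed_of p (Q : pair -> pair -> Prop) (y1 y2 : pair) d e :
  (1 <= p)%E -> pair_iso p d e ->
  (forall x y, pair_sphere p x -> pair_sphere p y -> Q x y -> Q (d x) (d y)) ->
  (forall x y, pair_sphere p x -> pair_sphere p y -> Q x y ->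
     x = apex \/ y = apex) ->
  pair_sphere p y1 -> pair_sphere p y2 -> Q apex y1 -> Q apex y2 -> y1 <> y2 ->
  d apex = apex.
Proof.
move=> p1 [dS eS ed de dI] Qd Qapex S1 S2 Q1 Q2 y12.
have Se := pair_sphere_apex p1.
have [//|d1] := Qapex _ _ (dS _ Se) (dS _ S1) (Qd _ _ Se S1 Q1).
have [//|d2] := Qapex _ _ (dS _ Se) (dS _ S2) (Qd _ _ Se S2 Q2).
by exfalso; apply: y12; rewrite -(ed _ S1) -(ed _ S2) d1 d2.
Qed.

Lemma pair_dst_apex p x : pair_dst p apex x = lpn p `|1 - x.1| (sup_norm01 x.2).
Proof. by rewrite /pair_dst dst0. Qed.

End pairs.

Section pairs_oo.
Context {R : realType}.
Implicit Types (a b c : R) (u v w : I01 R -> R).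

Local Notation pair := (R * (I01 R -> R))%type.
Implicit Types (x y m : pair).

Lemma pair_dst_oo_le x y c :
  (pair_dst +oo x y <= c) = (`|x.1 - y.1| <= c) && (dst x.2 y.2 <= c).
Proof. by rewrite /pair_dst /lpn ge_max. Qed.

Lemma pair_dst_oo_lt x y c :
  (pair_dst +oo x y < c) = (`|x.1 - y.1| < c) && (dst x.2 y.2 < c).
Proof. by rewrite /pair_dst /lpn gt_max. Qed.

Lemma pair_dst_ooE x y :
  pair_dst +oo x y = Num.max `|x.1 - y.1| (dst x.2 y.2).
Proof. by []. Qed.

Lemma pair_sphere_ooP x : pair_sphere +oo x ->
  [/\ continuous x.2, 0 <= x.1 <= 1, forall t, 0 <= x.2 t <= 1 &
      x.1 = 1 \/ exists t, x.2 t = 1].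
Proof.
move=> Sx; have p1 : (1 <= +oo :> \bar R)%E by rewrite leey.
have [cu a0 u0 n1] := Sx; have [a1 _] := pair_sphere_le1 p1 Sx.
split=> //; [by rewrite a0 a1|exact: (pair_sphere_bound p1 Sx)|].
move: n1; rewrite /lpn; case: leP => _; last by left.
move=> n1; right; have [_ _ //] : pos_unit x.2 by apply/pos_unitE.
Qed.

Lemma pair_sphere_oo_intro a u : continuous u -> 0 <= a <= 1 ->
  (forall t, 0 <= u t <= 1) -> a = 1 \/ (exists t, u t = 1) ->
  pair_sphere +oo (a, u).
Proof.
move=> cu /andP[a0 a1] u01 H.
have n1 : sup_norm01 u <= 1.
  by apply: sup_norm01_le => t; have /andP[? ?] := u01 t; rewrite ger0_norm.
split=> //= [t|]; first by have /andP[] := u01 t.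
case: H => [->|Hu]; first exact/max_idPl.
have /pos_unitE[_ _ ->] : pos_unit u by [].
exact/max_idPr.
Qed.

End pairs_oo.

(** * The apex and the first coordinate for finite exponents *)

(* Unification would otherwise unfold these constants down to the definition
   of the real power function. *)
#[local] Opaque powR sup_norm01 dst lpn pair_dst.

Section rigidity_fin.
Context {R : realType}.
Implicit Types (p : \bar R) (r a b : R) (u v w : I01 R -> R).

Local Notation pair := (R * (I01 R -> R))%type.
Implicit Types (x y m : pair).

Lemma pair_sphere_finP r x : 1 <= r -> pair_sphere r%:E x ->
  x.1 `^ r + sup_norm01 x.2 `^ r = 1.
Proof.
move=> r1 [_ _ _ /(congr1 (fun z => z `^ r))].
by rewrite (lpn_finK _ _ r1) powR1.
Qed.

Lemma ler_powR_nneg r a b : 1 <= r -> 0 <= a -> a <= b -> a `^ r <= b `^ r.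
Proof.
move=> r1 a0 ab.
have r0 : 0 <= r := le_trans ler01 r1.
by apply: (ge0_ler_powR r0) => //; rewrite nnegrE // (le_trans a0).
Qed.

Lemma diameter_fin_num (r a b n m d : R) : 1 <= r -> 0 <= b -> b <= a ->
  0 <= n -> 0 <= m -> 0 <= d -> d <= Num.max n m ->
  a `^ r + n `^ r = 1 -> b `^ r + m `^ r = 1 -> (a - b) `^ r + d `^ r = 2 ->
  a = 1 /\ n = 0.
Proof.
move=> r1 b0 ba n0 m0 d0 dnm Ea Eb Ed.
have h1 : (a - b) `^ r <= a `^ r.
  by apply: (ler_powR_nneg r1); [rewrite subr_ge0|rewrite lerBlDr lerDl].
have h2 : b `^ r <= a `^ r := ler_powR_nneg r1 b0 ba.
have nm : n <= m.
  rewrite leNgt; apply/negP => mn.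
  have : m `^ r < n `^ r by rewrite gt0_ltr_powR ?nnegrE // (lt_le_trans ltr01).
  by move: Ea Eb h2; move: (a `^ r) (b `^ r) (m `^ r) (n `^ r) => *; lra.
rewrite (max_idPr nm) in dnm.
have h3 : d `^ r <= m `^ r := ler_powR_nneg r1 d0 dnm.
have [a1 n1] : a `^ r = 1 /\ n `^ r = 0.
  move: (powR_ge0 b r) (powR_ge0 n r) Ea Eb Ed h1 h2 h3.
  move: (a `^ r) (b `^ r) (m `^ r) (n `^ r) (d `^ r) ((a - b) `^ r).
  by move=> *; split; lra.
split; last exact: powR_eq0_eq0 n1.
by apply: (powR_inj_nneg r1 (le_trans b0 ba) ler01); rewrite a1 powR1.
Qed.

Lemma dst_le_max u v : continuous u -> continuous v ->
  (forall t, 0 <= u t) -> (forall t, 0 <= v t) ->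
  dst u v <= Num.max (sup_norm01 u) (sup_norm01 v).
Proof.
move=> cu cv u0 v0; apply: dst_le => t.
have hu : u t <= sup_norm01 u by rewrite -{1}(ger0_norm (u0 t)) le_sup_norm01.
have hv : v t <= sup_norm01 v by rewrite -{1}(ger0_norm (v0 t)) le_sup_norm01.
rewrite le_max; case: (lerP (u t) (v t)) => uv; apply/orP; [right|left].
  by apply: le_trans hv; rewrite lerBlDr lerDl.
by apply: le_trans hu; rewrite lerBlDr lerDl.
Qed.

(** The diameter of the sphere is the distance from the apex to the slice of
    height 0, and it is attained nowhere else. *)
Lemma diameter_fin r x y : 1 <= r ->
  pair_sphere r%:E x -> pair_sphere r%:E y ->
  pair_dst r%:E x y = lpn r%:E 1 1 -> x = apex \/ y = apex.
Proof.
move=> r1; wlog yx : x y / y.1 <= x.1.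
  move=> H Sx Sy xy; have [yx|/ltW xy'] := leP y.1 x.1; first exact: H.
  rewrite (pair_dstC _ x y) in xy.
  by have [->|->] := H y x xy' Sy Sx xy; [right|left].
move=> Sx Sy xy; left.
have H : pair_dst r%:E x y `^ r = 2 by rewrite xy lpn_fin11.
have xy0 : 0 <= x.1 - y.1 by rewrite subr_ge0.
rewrite (pair_dst_finK _ _ r1) (ger0_norm xy0) in H.
have Ex := pair_sphere_finP r1 Sx; have Ey := pair_sphere_finP r1 Sy.
have [cu a0 u0 _] := Sx; have [cv b0 v0 _] := Sy.
have [x1 n0] := diameter_fin_num r1 b0 yx (sup_norm01_ge0 cu)
  (sup_norm01_ge0 cv) (dst_ge0 cu cv) (dst_le_max cu cv u0 v0) Ex Ey H.
by rewrite (surjective_pairing x) x1 (sup_norm01_eq0 cu n0).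
Qed.

Lemma pos_unit1_neq_coord : ((fun=> 1) : I01 R -> R) <> coord01.
Proof.
move=> /(congr1 (fun f => f (clamp 0))).
by rewrite coord01_clamp ?lexx ?ler01 // => /eqP; rewrite oner_eq0.
Qed.

Lemma apex_fixed_fin r d e : 1 <= r -> pair_iso r%:E d e -> d apex = apex.
Proof.
move=> r1 iso; have p1 : (1 <= r%:E)%E by rewrite lee_fin.
have Q u : pos_unit u -> pair_dst r%:E apex (0, u) = lpn r%:E 1 1.
  by move=> /pos_unitE[_ _ n1]; rewrite pair_dst_apex /= n1 subr0 normr1.
have [dS eS ed de dI] := iso.
apply: (@apex_fixed_of _ r%:E (fun x y => pair_dst r%:E x y = lpn r%:E 1 1)
  (0, fun=> 1) (0, coord01) d e p1 iso).
- by move=> x y Sx Sy; rewrite (dI _ _ Sx Sy).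
- by move=> x y; exact: diameter_fin.
- exact: (pair_sphere_slice0 _ p1).2 pos_unit1.
- exact: (pair_sphere_slice0 _ p1).2 pos_unit_coord01.
- exact: Q pos_unit1.
- exact: Q pos_unit_coord01.
- by move=> [/pos_unit1_neq_coord].
Qed.

(** Along the sphere the distance to the apex decreases strictly with the first
    coordinate. *)
Lemma first_fixed_num (r a b n m : R) : 1 <= r ->
  0 <= a <= 1 -> 0 <= b <= 1 -> a `^ r + n `^ r = 1 -> b `^ r + m `^ r = 1 ->
  lpn r%:E (1 - b) m = lpn r%:E (1 - a) n -> b = a.
Proof.
move=> r1 /andP[a0 a1] /andP[b0 b1] Ea Eb H.
have {H} := etrans (esym (lpn_finK _ _ r1))
  (etrans (congr1 (fun z => z `^ r) H) (lpn_finK _ _ r1)).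
have key s t : 0 <= s -> s < t -> t <= 1 ->
    s `^ r < t `^ r /\ (1 - t) `^ r <= (1 - s) `^ r.
  move=> s0 st t1; split; last by apply: (ler_powR_nneg r1); lra.
  rewrite gt0_ltr_powR ?nnegrE ?(le_trans s0 (ltW st)) //.
  exact: lt_le_trans ltr01 r1.
have [ab|ab|//] := ltgtP b a.
- have [] := key _ _ b0 ab a1; move: Ea Eb.
  by move: (_ `^ r) (_ `^ r) (_ `^ r) (_ `^ r) (_ `^ r) (_ `^ r) => *; lra.
- have [] := key _ _ a0 ab b1; move: Ea Eb.
  by move: (_ `^ r) (_ `^ r) (_ `^ r) (_ `^ r) (_ `^ r) (_ `^ r) => *; lra.
Qed.

Lemma first_fixed_fin r d e x : 1 <= r -> pair_iso r%:E d e ->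
  pair_sphere r%:E x -> (d x).1 = x.1.
Proof.
move=> r1 iso Sx; have p1 : (1 <= r%:E)%E by rewrite lee_fin.
have [dS eS ed de dI] := iso; have Sdx := dS _ Sx.
have H := dI _ _ (pair_sphere_apex p1) Sx.
rewrite (apex_fixed_fin r1 iso) in H.
rewrite (pair_dst_apex _ x) (pair_dst_apex _ (d x)) in H.
have [a1 _] := pair_sphere_le1 p1 Sx; have [b1 _] := pair_sphere_le1 p1 Sdx.
have [_ a0 _ _] := Sx; have [_ b0 _ _] := Sdx.
have na : `|1 - x.1| = 1 - x.1 by apply: ger0_norm; rewrite subr_ge0.
have nb : `|1 - (d x).1| = 1 - (d x).1 by apply: ger0_norm; rewrite subr_ge0.
rewrite na nb in H.
apply: (first_fixed_num r1 _ _ (pair_sphere_finP r1 Sx)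
  (pair_sphere_finP r1 Sdx) H).
- by rewrite a0 a1.
- by rewrite b0 b1.
Qed.

End rigidity_fin.

(** * The apex and the first coordinate for the exponent +oo *)

Section rigidity_oo.
Context {R : realType}.
Implicit Types (a b c : R) (u v w : I01 R -> R).

Local Notation pair := (R * (I01 R -> R))%type.
Implicit Types (x y m : pair).

Lemma half_dst_le u w (h : R) : (forall t, u t - h <= w t <= u t + h) ->
  dst u w <= h.
Proof.
by move=> H; apply: dst_le => t; rewrite ler_norml; have := H t; lra.
Qed.

(** Points of the sphere at distance at most 1/2 from both [x] and [y]. *)
Definition midpoint x y m : Prop :=
  [/\ pair_sphere +oo m, pair_dst +oo x m <= 2^-1 & pair_dst +oo y m <= 2^-1].

Definition unique_midpoint x y : Prop :=
  exists2 m, midpoint x y m & forall m', midpoint x y m' -> m = m'.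

Lemma midpoint_intro a b c u v w :
  `|a - c| <= 2^-1 -> `|b - c| <= 2^-1 -> continuous w -> 0 <= c <= 1 ->
  (forall t, 0 <= w t <= 1) ->
  (forall t, u t - 2^-1 <= w t <= u t + 2^-1) ->
  (forall t, v t - 2^-1 <= w t <= v t + 2^-1) ->
  c = 1 \/ (exists t, w t = 1) -> midpoint (a, u) (b, v) (c, w).
Proof.
move=> ac bc cw c01 w01 uw vw H; split.
- exact: pair_sphere_oo_intro.
- by rewrite pair_dst_oo_le ac; apply: half_dst_le.
- by rewrite pair_dst_oo_le bc; apply: half_dst_le.
Qed.

Lemma midpoint_elim a b c u v w : continuous u -> continuous v ->
  midpoint (a, u) (b, v) (c, w) ->
  [/\ `|a - c| <= 2^-1, `|b - c| <= 2^-1,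
      forall t, u t - 2^-1 <= w t <= u t + 2^-1 &
      forall t, v t - 2^-1 <= w t <= v t + 2^-1].
Proof.
move=> cu cv [[/= cw _ _ _]].
rewrite !pair_dst_oo_le => /andP[/= ac uw] /andP[/= bc vw].
split=> // t.
  have := le_trans (le_dst t cu cw) uw.
  by rewrite ler_norml; lra.
have := le_trans (le_dst t cv cw) vw.
by rewrite ler_norml; lra.
Qed.

Lemma unique_midpoint_iso (d e : pair -> pair) x y : pair_iso +oo d e ->
  pair_sphere +oo x -> pair_sphere +oo y ->
  unique_midpoint x y -> unique_midpoint (d x) (d y).
Proof.
move=> [dS eS ed de dI] Sx Sy [m [Sm xm ym] Hm]; exists (d m).
  by split; [exact: dS|rewrite dI|rewrite dI].
move=> m' [Sm' xm' ym']; rewrite (Hm (e m')) ?de //.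
split; first exact: eS.
  by rewrite -(dI _ _ Sx (eS _ Sm')) de.
by rewrite -(dI _ _ Sy (eS _ Sm')) de.
Qed.

Lemma opposite_values u v : continuous u ->
  (forall t, (u t = 0 /\ v t = 1) \/ (u t = 1 /\ v t = 0)) ->
  (forall t, u t = 0) \/ (forall t, v t = 0).
Proof.
move=> cu H; case: (H (zero01 R)) => -[u0 _]; [left|right] => t.
  case: (H t) => -[ut _] //.
  have [|s us] := @IVT01 _ u 2^-1 (zero01 R) t cu; first by rewrite u0 ut; lra.
  by case: (H s) => -[]; rewrite us => h _; exfalso; lra.
case: (H t) => -[ut] //.
have [|s us] := @IVT01 _ u 2^-1 t (zero01 R) cu; first by rewrite u0 ut; lra.
by case: (H s) => -[]; rewrite us => h _; exfalso; lra.
Qed.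

(** The admissible interval for a value at distance at most 1/2 from [s] and [t]
    within [0,1] is a single point only if [s] and [t] are the two endpoints. *)
Lemma pinch_num (s t : R) : 0 <= s <= 1 -> 0 <= t <= 1 ->
  Num.max 0 (Num.max (s - 2^-1) (t - 2^-1)) =
  Num.min 1 (Num.min (s + 2^-1) (t + 2^-1)) ->
  (s = 0 /\ t = 1) \/ (s = 1 /\ t = 0).
Proof.
move=> s01 t01; case: (leP 0 (Num.max (s - 2^-1) (t - 2^-1)));
  case: (leP 1 (Num.min (s + 2^-1) (t + 2^-1)));
  case: (leP (s - 2^-1) (t - 2^-1)); case: (leP (s + 2^-1) (t + 2^-1)) => *;
  solve [exfalso; lra | left; split; lra | right; split; lra].
Qed.

(** The midpoints of [(a, u)] and [(b, v)] with first coordinate [c] are the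
    [(c, w)] in the sphere with [L <= w <= U]. If [c = 1], then any such [w] is
    allowed, so uniqueness forces [L = U]; then [u] and [v] are the constants 0
    and 1.
    Otherwise [w] has a peak [t0], and uniqueness forces [L = U] off [t0]; then
    [|u - v|] is 1 off [t0] and at most 1/2 at [t0], which contradicts the
    intermediate value theorem. *)
Lemma unique_midpoint_apex x y : pair_sphere +oo x -> pair_sphere +oo y ->
  unique_midpoint x y -> x = apex \/ y = apex.
Proof.
case: x => a u; case: y => b v Sx Sy [[c w] Mm uniq].
have [/= cu a01 u01 Hx] := pair_sphere_ooP Sx.
have [/= cv b01 v01 Hy] := pair_sphere_ooP Sy.
have [ac bc uw vw] := midpoint_elim cu cv Mm.
have [Sm _ _] := Mm; have [/= cw c01 w01 Hm] := pair_sphere_ooP Sm.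
pose U t := Num.min 1 (Num.min (u t + 2^-1) (v t + 2^-1)).
pose L t := Num.max 0 (Num.max (u t - 2^-1) (v t - 2^-1)).
have cU : continuous U by rewrite /U; auto 8.
have cL : continuous L by rewrite /L; auto 8.
have LU t : [/\ 0 <= L t, L t <= w t, w t <= U t & U t <= 1].
  have /andP[h1 h2] := uw t; have /andP[h3 h4] := vw t.
  have /andP[h5 h6] := w01 t; rewrite /U /L.
  by split; rewrite ?le_max ?ge_max ?le_min ?ge_min ?lexx
    ?h1 ?h2 ?h3 ?h4 ?h5 ?h6.
have inner w' : continuous w' -> (forall t, L t <= w' t <= U t) ->
    c = 1 \/ (exists t, w' t = 1) -> w' = w.
  move=> cw' w'LU Hw'; suff Mm' : midpoint (a, u) (b, v) (c, w').
    by have [] := uniq _ Mm'.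
  apply: midpoint_intro => // t.
  - by have [] := LU t; have := w'LU t; lra.
  - by have := w'LU t; rewrite /U /L !ge_max !le_min; lra.
  - by have := w'LU t; rewrite /U /L !ge_max !le_min; lra.
have pinch t : L t = U t -> (u t = 0 /\ v t = 1) \/ (u t = 1 /\ v t = 0).
  by apply: pinch_num; [exact: u01|exact: v01].
have LwU t : L t <= U t by have [_ h1 h2 _] := LU t; exact: le_trans h2.
clearbody U L.
have [c1|[t0 wt0]] : c = 1 \/ exists t, w t = 1 by [].
  have LE : L = w by apply: inner; [|move=> t; rewrite lexx LwU|left].
  have UE : U = w by apply: inner; [|move=> t; rewrite lexx LwU|left].
  have H t : (u t = 0 /\ v t = 1) \/ (u t = 1 /\ v t = 0).
    by apply: pinch; rewrite LE UE.
  have [u0|v0] := opposite_values cu H.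
    left; case: Hx => [->|[t ut]].
      by congr (_, _); apply/funext.
    by have := u0 t; rewrite ut => /eqP; rewrite oner_eq0.
  right; case: Hy => [->|[t vt]].
    by congr (_, _); apply/funext.
  by have := v0 t; rewrite vt => /eqP; rewrite oner_eq0.
exfalso.
have Ut0 : U t0 = 1.
  by apply/eqP; rewrite eq_le; have [_ _ + ->] := LU t0; rewrite wt0.
have UE : U = w.
  by apply: inner; [|move=> t; rewrite lexx LwU|right; exists t0].
(* [L'] still reaches 1 at [t0] but lies below [U] elsewhere, unless [L] meets
   [U] there. *)
pose L' t := Num.max (L t) (U t - `|coord01 t - coord01 t0|).
have L'E : L' = w.
  apply: inner; first by rewrite /L'; auto 8.
    move=> t; rewrite /L' le_max lexx ge_max LwU /=.
    by rewrite lerBlDr lerDl normr_ge0.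
  right; exists t0; rewrite /L' subrr normr0 subr0 Ut0; apply/max_idPr.
  by rewrite -Ut0.
have off t : t != t0 -> (u t = 0 /\ v t = 1) \/ (u t = 1 /\ v t = 0).
  move=> tt0; apply: pinch.
  have gt0 : 0 < `|coord01 t - coord01 t0|.
    rewrite normr_gt0 subr_eq0; apply: contra_neq tt0; exact: coord01_inj.
  have : L' t = U t by rewrite L'E UE.
  by rewrite /L'; case: leP => // _ ?; exfalso; lra.
have [t1 t10] : exists t1, t1 != t0.
  have [->|h] := eqVneq t0 (clamp 0); last by exists (clamp 0); rewrite eq_sym.
  exists (clamp 1); apply/eqP => /(congr1 coord01).
  by rewrite !coord01_clamp ?lexx ?ler01 // => /eqP; rewrite oner_eq0.
have ch : continuous (fun t => `|u t - v t|) by auto.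
have [|z hz] := @IVT01 _ _ (3 / 4) t0 t1 ch.
  rewrite /=.
  have := uw t0; have := vw t0; rewrite wt0 => h1 h2.
  have := u01 t0; have := v01 t0 => h3 h4.
  case: (off t1 t10) => -[-> ->]; rewrite ?sub0r ?subr0 ?normrN normr1.
    by case: (lerP (u t0) (v t0)) => ?; lra.
  by case: (lerP (u t0) (v t0)) => ?; lra.
have [zt0|zt0] := eqVneq z t0.
  have := uw t0; have := vw t0; rewrite wt0 => h1 h2.
  have := u01 t0; have := v01 t0 => h3 h4.
  by move: hz; rewrite zt0; case: (lerP (u t0) (v t0)) => ?; lra.
move: hz; case: (off z zt0) => -[-> ->];
  by rewrite ?sub0r ?subr0 ?normrN normr1; lra.
Qed.

(** The midpoint is [(1, 1/2)]. *)
Lemma apex_unique_midpoint a : 2^-1 <= a <= 1 ->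
  unique_midpoint apex (a, fun=> 1).
Proof.
move=> a01; exists (1, fun=> 2^-1).
  apply: midpoint_intro; rewrite ?subrr ?normr0 ?invr_ge0 //.
  - by rewrite ler_norml; lra.
  - by rewrite ler01 lexx.
  - by move=> t; lra.
  - by move=> t; lra.
  - by move=> t; lra.
  - by left.
move=> [c w] Mm; have [_ _ h1 h2] := midpoint_elim (cont_cst 0) (cont_cst 1) Mm.
have wE t : w t = 2^-1 by have := h1 t; have := h2 t; lra.
have [Sm _ _] := Mm; have [/= _ _ _ [->|[t]]] := pair_sphere_ooP Sm.
  by congr (_, _); apply/funext => t; rewrite wE.
by rewrite wE => ?; exfalso; lra.
Qed.

Lemma apex_fixed_oo d e : pair_iso +oo d e -> d apex = apex :> pair.
Proof.
move=> iso.
have half1 : (2^-1 : R) <= 1 by rewrite invf_le1 ?ler1n.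
have h1 : (2^-1 : R) <= (1 : R) <= (1 : R) by rewrite half1 lexx.
have h2 : (2^-1 : R) <= (2^-1 : R) <= (1 : R) by rewrite lexx half1.
have S a : 2^-1 <= a <= 1 -> pair_sphere +oo (a, fun=> 1 : R).
  move=> a01; apply: pair_sphere_oo_intro => //; first lra.
  - by move=> t; rewrite ler01 lexx.
  - by right; exists (zero01 R).
have p1 : (1 <= +oo :> \bar R)%E by rewrite leey.
apply: (@apex_fixed_of _ +oo unique_midpoint (1, fun=> 1) (2^-1, fun=> 1)
  d e p1 iso).
- by move=> x y; exact: unique_midpoint_iso iso.
- exact: unique_midpoint_apex.
- exact: S _ h1.
- exact: S _ h2.
- exact: apex_unique_midpoint h1.
- exact: apex_unique_midpoint h2.
- by move=> [h]; lra.
Qed.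

(** The distance from [x] to the open unit ball around the apex is [1 - x.1];
    it is approached by scaling [x.2] down and raising [x.1] to 1. *)
Lemma near_apex_approx x h : pair_sphere +oo x -> 0 < h ->
  exists f, [/\ pair_sphere +oo f, pair_dst +oo apex f < 1 &
    pair_dst +oo x f <= 1 - x.1 + h].
Proof.
move=> Sx h0; have [cu /andP[a0 a1] u01 _] := pair_sphere_ooP Sx.
pose s := Num.min 1 (1 - x.1 + h).
have [s0 s1 sh] : [/\ 0 < s, s <= 1 & s <= 1 - x.1 + h].
  by rewrite /s; case: (leP 1 (1 - x.1 + h)) => ?; split; lra.
pose f : pair := (1, fun t => (1 - s) * x.2 t).
have cf : continuous f.2 by apply: contZ.
have f01 t : 0 <= f.2 t <= 1 - s.
  have /andP[u0 u1] := u01 t.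
  by rewrite mulr_ge0 ?subr_ge0 //= ler_piMr // subr_ge0.
exists f; split.
- apply: pair_sphere_oo_intro => //; [by rewrite ler01 lexx| |by left].
  by move=> t; have := f01 t; rewrite /=; lra.
- rewrite pair_dst_oo_lt subrr normr0 ltr01 /=.
  apply: (@le_lt_trans _ _ (1 - s)); last by rewrite gtrBl.
  apply: dst_le => t; rewrite sub0r normrN.
  by have /andP[f0 f1] := f01 t; rewrite ger0_norm.
- rewrite pair_dst_oo_le ler_norml; apply/andP; split=> /=; first lra.
  apply: dst_le => t; apply: le_trans sh.
  have /andP[u0 u1] := u01 t.
  rewrite (_ : _ - _ = s * x.2 t); last by ring.
  have su0 : 0 <= s * x.2 t by rewrite mulr_ge0 // ltW.
  by rewrite (ger0_norm su0) ler_piMr // ltW.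
Qed.

Lemma first_le_oo d e x : pair_iso +oo d e -> pair_sphere +oo x ->
  x.1 <= (d x).1.
Proof.
move=> iso Sx; have de := apex_fixed_oo iso.
have Sapex : pair_sphere +oo (apex : pair).
  by apply: pair_sphere_apex; rewrite leey.
have [dS eS _ _ dI] := iso.
have fin a b h : - (1 - a + h) <= b - 1 -> a <= b + h by lra.
apply/ler_addgt0Pl => h h0; rewrite addrC.
have [f [Sf ef xf]] := near_apex_approx Sx h0.
have Sdf := dS _ Sf.
have df1 : (d f).1 = 1.
  have [cdf _ _ [//|[t dft]]] := pair_sphere_ooP Sdf.
  have := dI _ _ Sapex Sf; rewrite de => H.
  move: ef; rewrite -H pair_dst_oo_lt => /andP[_ /=] lt1.
  have := le_lt_trans (le_dst t (cont_cst 0) cdf) lt1.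
  by rewrite dft sub0r normrN normr1 ltxx.
have := dI _ _ Sx Sf => H.
move: xf; rewrite -H pair_dst_oo_le df1 ler_norml => /andP[/andP[+ _] _].
exact: fin.
Qed.

Lemma first_fixed_oo d e x : pair_iso +oo d e -> pair_sphere +oo x ->
  (d x).1 = x.1.
Proof.
move=> iso Sx; apply/eqP; rewrite eq_le (first_le_oo iso Sx) andbT.
have [dS _ ed _ _] := iso.
by have := first_le_oo (pair_isoC iso) (dS _ Sx); rewrite (ed _ Sx).
Qed.

Lemma pos_unit_second_oo d e x : pair_iso +oo d e -> pair_sphere +oo x ->
  pos_unit x.2 -> pos_unit (d x).2.
Proof.
move=> iso Sx /pos_unitE[cu u0 n1].
have p1 : (1 <= +oo :> \bar R)%E by rewrite leey.
have [dS _ _ _ dI] := iso; have Sdx := dS _ Sx.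
have [cw _ w01 Hw] := pair_sphere_ooP Sdx; split=> //.
case: Hw => // dx1.
have H := dI _ _ (pair_sphere_apex p1) Sx.
rewrite (apex_fixed_oo iso) (pair_dst_ooE _ x) (pair_dst_ooE _ (d x)) in H.
rewrite dx1 -(first_fixed_oo iso Sx) dx1 in H.
rewrite (@dst0 _ x.2) (@dst0 _ (d x).2) n1 /= subrr normr0 in H.
have n1' : sup_norm01 (d x).2 = 1.
  by rewrite -(max_idPr (sup_norm01_ge0 cw)) H; apply/max_idPr.
have [_ _ //] : pos_unit (d x).2.
by apply/pos_unitE; split=> // t; have /andP[] := w01 t.
Qed.

End rigidity_oo.

(** * Surjective isometries of the positive sphere of the l^p-sum *)

Section rigidity.
Context {R : realType}.
Implicit Types (p : \bar R) (a b c : R) (u v w : I01 R -> R).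

Local Notation pair := (R * (I01 R -> R))%type.
Implicit Types (x y : pair).

Lemma first_fixed p d e x : (1 <= p)%E -> pair_iso p d e ->
  pair_sphere p x -> (d x).1 = x.1.
Proof.
case: p => [r||] //; last by move=> _; exact: first_fixed_oo.
by rewrite lee_fin; exact: first_fixed_fin.
Qed.

Lemma pair_iso_slice0 p d e : (1 <= p)%E -> pair_iso p d e ->
  pos_unit_iso (fun u => (d (0, u)).2) (fun u => (e (0, u)).2).
Proof.
move=> p1 iso; have iso' := pair_isoC iso; have [dS eS ed de dI] := iso.
have S0 u : pos_unit u -> pair_sphere p (0, u).
  by move/(pair_sphere_slice0 u p1).
have dE u : pos_unit u -> d (0, u) = (0, (d (0, u)).2).
  move=> Su; rewrite {1}(surjective_pairing (d (0, u))).
  by rewrite (first_fixed p1 iso (S0 _ Su)).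
have eE u : pos_unit u -> e (0, u) = (0, (e (0, u)).2).
  move=> Su; rewrite {1}(surjective_pairing (e (0, u))).
  by rewrite (first_fixed p1 iso' (S0 _ Su)).
split.
- move=> u Su; apply/(pair_sphere_slice0 _ p1); rewrite -(dE _ Su).
  by apply: dS; exact: S0.
- move=> u Su; apply/(pair_sphere_slice0 _ p1); rewrite -(eE _ Su).
  by apply: eS; exact: S0.
- by move=> u Su; rewrite -(dE _ Su) (ed _ (S0 _ Su)).
- by move=> u Su; rewrite -(eE _ Su) (de _ (S0 _ Su)).
- move=> u v Su Sv; have := dI _ _ (S0 _ Su) (S0 _ Sv).
  have [cdu _ _ _] := dS _ (S0 _ Su); have [cdv _ _ _] := dS _ (S0 _ Sv).
  have [cu _ _] := Su; have [cv _ _] := Sv.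
  rewrite !pair_dstE (dE _ Su) (dE _ Sv) /= subrr normr0.
  rewrite (lpn0l p1 (dst_ge0 cdu cdv)) (lpn0l p1 (dst_ge0 cu cv)).
  by [].
Qed.

Lemma lpn_finI r a b c : 1 <= r -> 0 <= b -> 0 <= c ->
  lpn r%:E a b = lpn r%:E a c -> b = c.
Proof.
move=> r1 b0 c0 H.
have {H} := etrans (esym (lpn_finK _ _ r1))
  (etrans (congr1 (fun z => z `^ r) H) (lpn_finK _ _ r1)).
by move=> /addrI; exact: powR_inj_nneg.
Qed.

(** Every surjective isometry of the positive sphere comes from a homeomorphism
    of the unit interval. *)
Theorem pair_isoP p d e : (1 <= p)%E -> pair_iso p d e ->
  exists phi psi : I01 R -> I01 R,
    [/\ continuous phi, continuous psi, cancel phi psi, cancel psi phi &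
        forall x, pair_sphere p x -> d x = (x.1, x.2 \o psi)].
Proof.
have half2 : (1 : R) <= 2^-1 + 2^-1 by lra.
move=> p1 iso; have [dS eS ed de dI] := iso.
have [phi [psi [cphi cpsi phiK psiK d0]]] :=
  pos_unit_isoP (pair_iso_slice0 p1 iso).
exists phi, psi; split=> //.
have first x (Sx : pair_sphere p x) := first_fixed p1 iso Sx.
have cont2 x (Sx : pair_sphere p x) : continuous x.2 by case: Sx.
pose agree x := d x = (x.1, x.2 \o psi).
have agreeI x : pair_sphere p x -> (d x).2 \o phi = x.2 -> agree x.
  move=> Sx H; rewrite /agree (surjective_pairing (d x)) (first x Sx) -H.
  by congr (_, _); apply/funext => t /=; rewrite psiK.
have cw x : pair_sphere p x -> continuous ((d x).2 \o phi).
  move=> Sx t; apply: continuous_comp; first exact: cphi.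
  exact: (cont2 _ (dS _ Sx)).
(* If [d] is known at [(b, v)] for all [v] in the positive unit sphere, then the
   second component of [d x], pulled back by [phi], is as far from [v] as [x.2]
   is, up to what the norm hides at the height difference [x.1 - b]. *)
have transfer b x v : pair_sphere p (b, v) -> agree (b, v) -> pair_sphere p x ->
    lpn p `|x.1 - b| (dst ((d x).2 \o phi) v) = lpn p `|x.1 - b| (dst x.2 v).
  move=> Sbv Abv Sx; have := dI _ _ Sx Sbv.
  rewrite !pair_dstE (first _ Sx) Abv /= => <-; congr (lpn _ _ _).
  have cv := cont2 _ Sbv.
  have cvpsi := cont_comp cpsi cv.
  rewrite -(dst_comp (cont2 _ (dS _ Sx)) cvpsi cphi psiK); congr dst.
  by apply/funext => t /=; rewrite phiK.
have agree0 v : pos_unit v -> agree (0, v).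
  move=> Sv; have S0 := (pair_sphere_slice0 v p1).2 Sv.
  rewrite /agree (surjective_pairing (d (0, v))) (first _ S0) /=.
  by rewrite -d0.
have bounds x : pair_sphere p x -> forall t, 0 <= x.2 t <= 1.
  exact: pair_sphere_bound.
have cst_dst x v (Sx : pair_sphere p x) (Sv : pos_unit v) :
    0 <= dst ((d x).2 \o phi) v /\ 0 <= dst x.2 v.
  have [cv _ _] := Sv.
  by split; apply: dst_ge0 => //; [exact: cw|exact: cont2].
have [[r pE r1]|pE] : (exists2 r, p = r%:E & 1 <= r) \/ p = +oo%E.
  by case: p p1 {iso dS eS ed de dI d0 first cont2 agree agreeI cw transfer
    agree0 bounds cst_dst} => [r||] // p1; [left; exists r|right].
  subst p => x Sx.
  apply: (agreeI _ Sx); apply: detect_eq0 => //.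
  - exact: cont2.
  - exact: cw.
  - exact: bounds.
  - by move=> t; apply: (bounds _ (dS _ Sx)).
  - move=> v Sv; have [h1 h2] := cst_dst _ _ Sx Sv.
    apply: (lpn_finI r1 h1 h2 (transfer 0 x v _ _ Sx)); last exact: agree0.
    by apply/(pair_sphere_slice0 _ p1).
subst p.
have Sb b v : 0 <= b <= 1 -> pos_unit v -> pair_sphere +oo (b, v).
  move=> b01 [cv v01 [t vt]]; apply: pair_sphere_oo_intro => //.
  by right; exists t.
have step b a u : 0 <= b <= 1 -> 0 <= a <= 1 -> `|a - b| <= 2^-1 ->
    (forall v, pos_unit v -> agree (b, v)) -> pos_unit u -> agree (a, u).
  move=> b01 a01 ab Hb Su; have Sx := Sb _ _ a01 Su.
  apply: (agreeI _ Sx); apply: (detect_eq (c := `|a - b|)) => //.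
    by apply: (pos_unit_comp cphi psiK); apply: (pos_unit_second_oo iso Sx).
  by move=> v Sv; exact: (transfer b (a, u) v (Sb _ _ b01 Sv) (Hb _ Sv) Sx).
have agree_low a u : 0 <= a <= 2^-1 -> pos_unit u -> agree (a, u).
  move=> /andP[a0 a1]; apply: (step 0) => //.
  - by rewrite lexx ler01.
  - by rewrite a0 (le_trans a1) // invf_le1 // ler1n.
  - by rewrite subr0 ger0_norm.
have agree_high a u : 0 <= a <= 1 -> pos_unit u -> agree (a, u).
  move=> /andP[a0 a1] Su; have [a2|a2] := leP a 2^-1.
    by apply: agree_low => //; rewrite a0.
  apply: (step 2^-1) => //.
  - by rewrite invr_ge0 ler0n invf_le1 // ler1n.
  - by rewrite a0.
  - rewrite ger0_norm ?subr_ge0 ?(ltW a2) // lerBlDr.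
    exact: le_trans a1 half2.
  - by move=> v Sv; apply: agree_low => //; rewrite lexx invr_ge0 ler0n.
move=> x Sx; have [cx x01 _ Hx] := pair_sphere_ooP Sx.
case: Hx => [x1|Hx]; last first.
  rewrite (surjective_pairing x); apply: (agree_high x.1 x.2) => //.
  by split=> //; exact: bounds.
(* Only height 1 contains points with a second component of norm less than 1,
   and there the slice of height 1 itself serves for comparison. *)
apply: (agreeI _ Sx); apply: detect_eq0 => //.
- exact: cw.
- exact: bounds.
- by move=> t; apply: (bounds _ (dS _ Sx)).
- move=> v Sv; have [h1 h2] := cst_dst _ _ Sx Sv.
  have I1 : (0 : R) <= (1 : R) <= (1 : R) by rewrite ler01 lexx.
  have := transfer 1 x v (Sb _ _ I1 Sv) (agree_high _ _ I1 Sv) Sx.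
  by rewrite x1 subrr normr0 (lpn0l p1 h1) (lpn0l p1 h2).
Qed.

End rigidity.

(** * Transfer to continuously differentiable functions *)

#[local] Transparent lpn dst pair_dst.

Section C1_pairs.
Context {R : realType}.
Implicit Types (p : \bar R) (f g : C1 R).

Local Notation pair := (R * (I01 R -> R))%type.
Implicit Types (x y : pair).

(** The identification of a function with its initial value and derivative. *)
Definition pair_of_C1 f : pair := (f (zero01 R), deriv01 f).

(** The inverse identification, with value 0 if the second component is not
    continuous. *)
Definition C1_of_pair x : C1 R :=
  if pselect (continuous x.2) is left cx then
    projT1 (cid (C1_exists x.1 cx)) else 0.

Lemma C1_of_pairK x : continuous x.2 -> pair_of_C1 (C1_of_pair x) = x.
Proof.
move=> cx; rewrite /C1_of_pair; case: pselect => // cx'.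
by case: cid => f /= [f0 f']; rewrite /pair_of_C1 f0 f' -surjective_pairing.
Qed.

Lemma pair_of_C1_inj : injective pair_of_C1.
Proof. by move=> f g [f0 f']; exact: C1_eq. Qed.

Lemma pair_of_C1_continuous f : continuous (pair_of_C1 f).2.
Proof. exact: deriv01_continuous. Qed.

Lemma pair_of_C1K f : C1_of_pair (pair_of_C1 f) = f.
Proof.
by apply: pair_of_C1_inj; rewrite C1_of_pairK //; exact: pair_of_C1_continuous.
Qed.

Lemma norm_sigmaE p f :
  norm_sigma p f = lpn p `|(pair_of_C1 f).1| (sup_norm01 (pair_of_C1 f).2).
Proof. by case: p. Qed.

Lemma norm_sigmaB p f g :
  norm_sigma p (f - g) = pair_dst p (pair_of_C1 f) (pair_of_C1 g).
Proof. by rewrite norm_sigmaE /pair_of_C1 deriv01B. Qed.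

Lemma C1_leP f g : C1_le f g <->
  (pair_of_C1 f).1 <= (pair_of_C1 g).1 /\
  forall t, (pair_of_C1 f).2 t <= (pair_of_C1 g).2 t.
Proof. by []. Qed.

Lemma pair_of_C10 : pair_of_C1 0 = (0, fun=> 0).
Proof.
rewrite /pair_of_C1; congr (_, _).
by rewrite -[0 : C1 R](subrr (0 : C1 R)) deriv01B subrr.
Qed.

Lemma pos_sphereP p f : pos_sphere p f <-> pair_sphere p (pair_of_C1 f).
Proof.
rewrite /pos_sphere /pair_sphere /= norm_sigmaE C1_leP pair_of_C10 /=.
split=> [[n1 [a0 u0]]|[_ a0 u0 n1]].
  by split=> //; [exact: deriv01_continuous|rewrite -n1 ger0_norm].
by split=> //; rewrite ger0_norm.
Qed.

Lemma lpn_eq0 p (a b : R) : (1 <= p)%E -> 0 <= a -> 0 <= b ->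
  lpn p a b = 0 -> a = 0 /\ b = 0.
Proof.
case: p => [r||] //.
  rewrite lee_fin => r1 a0 b0 /powR_eq0_eq0/eqP.
  rewrite paddr_eq0 ?powR_ge0 // => /andP[/eqP ar /eqP br].
  by split; [exact: powR_eq0_eq0 ar|exact: powR_eq0_eq0 br].
move=> _ a0 b0 /= H; split; apply/eqP; rewrite eq_le; apply/andP; split=> //.
  by rewrite -H le_max lexx.
by rewrite -H le_max lexx orbT.
Qed.

Lemma norm_sigma_eq p f g : (1 <= p)%E -> norm_sigma p (f - g) = 0 -> f = g.
Proof.
move=> p1; rewrite norm_sigmaB => /lpn_eq0 -/(_ p1)[//||].
  by apply: dst_ge0; exact: deriv01_continuous.
move=> /eqP; rewrite normr_eq0 subr_eq0 => /eqP fg0 fg'.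
apply: C1_eq => //; apply/funext => t; apply/eqP.
rewrite -subr_eq0 -normr_eq0 eq_le normr_ge0 andbT -fg'.
exact: (le_dst t (@deriv01_continuous R f) (@deriv01_continuous R g)).
Qed.

(** A map of the positive sphere of C1[0,1], seen as a map of pairs that is the
    identity outside the sphere. *)
Definition lift_sphere p (F : pos_sphere p -> pos_sphere p) x : pair :=
  if pselect (pos_sphere p (C1_of_pair x)) is left Sx then
    pair_of_C1 (\val (F (exist _ (C1_of_pair x) (mem_set Sx)))) else x.

Lemma lift_sphereE p (F : pos_sphere p -> pos_sphere p) (f : pos_sphere p) :
  lift_sphere F (pair_of_C1 (\val f)) = pair_of_C1 (\val (F f)).
Proof.
rewrite /lift_sphere; case: pselect => [Sf|]; last first.
  by rewrite pair_of_C1K => -[]; exact: (set_mem (valP f)).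
congr (pair_of_C1 (\val (F _))); apply: val_inj => /=.
by rewrite pair_of_C1K.
Qed.

Lemma pair_sphere_lift p x : pair_sphere p x ->
  exists f : pos_sphere p, x = pair_of_C1 (\val f).
Proof.
move=> Sx; have cx : continuous x.2 by case: Sx.
have Sf : pos_sphere p (C1_of_pair x) by apply/pos_sphereP; rewrite C1_of_pairK.
by exists (exist _ (C1_of_pair x) (mem_set Sf)); rewrite /= C1_of_pairK.
Qed.

Lemma lift_pair_iso p (F G : pos_sphere p -> pos_sphere p) :
  cancel F G -> cancel G F -> isometry_on p F ->
  pair_iso p (lift_sphere F) (lift_sphere G).
Proof.
move=> FK GK FI; split.
- move=> x /pair_sphere_lift[f ->]; rewrite lift_sphereE.
  by apply/pos_sphereP; exact: (set_mem (valP (F f))).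
- move=> x /pair_sphere_lift[f ->]; rewrite lift_sphereE.
  by apply/pos_sphereP; exact: (set_mem (valP (G f))).
- by move=> x /pair_sphere_lift[f ->]; rewrite !lift_sphereE FK.
- by move=> x /pair_sphere_lift[f ->]; rewrite !lift_sphereE GK.
- move=> x y /pair_sphere_lift[f ->] /pair_sphere_lift[g ->].
  by rewrite !lift_sphereE -!norm_sigmaB; exact: FI.
Qed.

(** The function with the initial value of [f] and the derivative of [f]
    composed with [psi]. *)
Definition C1_comp (psi : I01 R -> I01 R) f : C1 R :=
  C1_of_pair (f (zero01 R), deriv01 f \o psi).

Lemma C1_compE (psi : I01 R -> I01 R) f : continuous psi ->
  pair_of_C1 (C1_comp psi f) = (f (zero01 R), deriv01 f \o psi).
Proof.
move=> cpsi; rewrite C1_of_pairK //= => t.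
by apply: continuous_comp; [exact: cpsi|exact: deriv01_continuous].
Qed.

Lemma C1_comp_at0 (psi : I01 R -> I01 R) f : continuous psi ->
  C1_comp psi f (zero01 R) = f (zero01 R).
Proof. by move=> cpsi; exact: (congr1 fst (C1_compE f cpsi)). Qed.

Lemma deriv01_C1_comp (psi : I01 R -> I01 R) f : continuous psi ->
  deriv01 (C1_comp psi f) = deriv01 f \o psi.
Proof. by move=> cpsi; exact: (congr1 snd (C1_compE f cpsi)). Qed.

#[local] Opaque C1_of_pair C1_comp deriv01.

Lemma C1_comp_linear (psi : I01 R -> I01 R) : continuous psi ->
  linear (C1_comp psi).
Proof.
move=> cpsi a f g; apply: C1_eq.
  rewrite (C1_comp_at0 _ cpsi).
  have atE (h k : C1 R) :
      (a *: h + k) (zero01 R) = a * h (zero01 R) + k (zero01 R).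
    by [].
  rewrite (atE f g) (atE (C1_comp psi f) (C1_comp psi g)).
  by rewrite (C1_comp_at0 f cpsi) (C1_comp_at0 g cpsi).
rewrite (deriv01_C1_comp _ cpsi) (deriv01D (a *: f)) (deriv01Z a f).
rewrite (deriv01D (a *: _)) (deriv01Z a (C1_comp psi f)).
by rewrite (deriv01_C1_comp f cpsi) (deriv01_C1_comp g cpsi).
Qed.

Lemma C1_comp_iso p (phi psi : I01 R -> I01 R) (T : {linear C1 R -> C1 R}) :
  continuous phi -> continuous psi -> cancel phi psi -> cancel psi phi ->
  T =1 C1_comp psi -> isometric_order_iso p T.
Proof.
move=> cphi cpsi phiK psiK TE; split.
- move=> g; exists (C1_comp phi g); rewrite TE; apply: C1_eq.
    by rewrite (C1_comp_at0 _ cpsi) (C1_comp_at0 _ cphi).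
  rewrite (deriv01_C1_comp _ cpsi) (deriv01_C1_comp _ cphi).
  by apply/funext => t /=; rewrite psiK.
- move=> f g; rewrite !TE !norm_sigmaB (C1_compE f cpsi) (C1_compE g cpsi).
  have H := dst_comp (@deriv01_continuous R f) (@deriv01_continuous R g)
    cpsi phiK.
  exact: (congr1 (lpn p `|f (zero01 R) - g (zero01 R)|) H).
- move=> f g; rewrite (TE f) (TE g); split=> -[fg0 fg']; split.
  + by move: fg0; rewrite (C1_comp_at0 f cpsi) (C1_comp_at0 g cpsi).
  + move=> t; move: (fg' (phi t)).
    by rewrite (deriv01_C1_comp f cpsi) (deriv01_C1_comp g cpsi) /= phiK.
  + by rewrite (C1_comp_at0 f cpsi) (C1_comp_at0 g cpsi).
  + move=> t; rewrite (deriv01_C1_comp f cpsi) (deriv01_C1_comp g cpsi).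
    exact: (fg' (psi t)).
Qed.

End C1_pairs.

Theorem corollary4p1 (R : realType) (p : \bar R) (hp : (1 <= p)%E)
    (Delta : pos_sphere p -> pos_sphere p)
    (Delta_surj : forall g, exists f, Delta f = g)
    (Delta_isometry : isometry_on p Delta) :
  exists T : {linear C1 R -> C1 R},
    isometric_order_iso p T /\
    forall f : pos_sphere p, T (\val f) = \val (Delta f).
Proof.
have [Gamma DG] := choice Delta_surj.
have Delta_inj : injective Delta.
  move=> f g fg; apply: val_inj; apply: (norm_sigma_eq hp).
  rewrite -Delta_isometry fg norm_sigmaB pair_dstE subrr normr0.
  have c := @pair_of_C1_continuous R (\val (Delta g)).
  have d0 : dst (pair_of_C1 (\val (Delta g))).2
      (pair_of_C1 (\val (Delta g))).2 = 0.
    apply/eqP; rewrite eq_le dst_ge0 // andbT; apply: dst_le => t.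
    by rewrite subrr normr0.
  by rewrite d0 lpn0l.
have GD : cancel Delta Gamma by move=> f; apply: Delta_inj; rewrite DG.
have iso := lift_pair_iso GD DG Delta_isometry.
have [phi [psi [cphi cpsi phiK psiK dE]]] := pair_isoP hp iso.
pose T : {linear C1 R -> C1 R} :=
  HB.pack_for {linear C1 R -> C1 R} (C1_comp psi)
  (GRing.isLinear.Build R (C1 R) (C1 R) _ (C1_comp psi) (C1_comp_linear cpsi)).
exists T; split; first exact: (C1_comp_iso p cphi cpsi phiK psiK).
move=> f; apply: pair_of_C1_inj; rewrite -lift_sphereE dE.
  exact: C1_compE.
by apply/pos_sphereP; exact: (set_mem (valP f)).
Qed.
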